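(* Let $M$ be a matroid on a finite ground set $E$ (loops allowed). Then its tropical matroid Schubert variety $Y_M\subseteq(\mathbb{TP}^1)^E$ is a tropical variety.
   Context: **Augmented Bergman fan and $Y_M$.** Let $(e_i)_{i\in E}$ be the standard basis of $\mathbb{R}^E$ and $e_S=\sum_{i\in S}e_i$. For $M$ loopless, a compatible pair $(I,\mathcal F)$ consists of an independent set $I$ and a (possibly empty) chain $\mathcal F$ of proper flats (flats $\neq E$) with $I\subseteq F$ for all $F\in\mathcal F$. The augmented Bergman fan $\Sigma_M^+$ is the simplicial fan in $\mathbb{R}^E$ with cones $\sigma_{I,\mathcal F}=\operatorname{cone}(e_i)_{i\in I}+\operatorname{cone}(-e_{E\setminus F})_{F\in\mathcal F}$, one for each compatible pair. If $M$ has set of loops $L$, $\Sigma^+_M$ is the image of $\Sigma^+_{M_L}$ under the inclusion $\mathbb{R}^{E\setminus L}\hookrightarrow\mathbb{R}^E$, where $M_L$ is the contraction of $M$ by $L$. Let $U_M=|\Sigma_M^+|$ be its support and $\mathbb{TP}^1=\mathbb{R}\cup\{-\infty,+\infty\}$ with the order topology. $Y_M$ is the topological closure of $U_M\subseteq\mathbb{R}^E$ in $(\mathbb{TP}^1)^E$. **Polyhedral structure.** For disjoint $J,K\subseteq E$ let $\eta_{J,K}=\operatorname{cone}(e_j)_{j\in J}+\operatorname{cone}(-e_k)_{k\in K}$ and $O(J,K)=\{x_j=+\infty\ (j\in J),\ x_k=-\infty\ (k\in K),\ x_i\in\mathbb{R}\text{ otherwise}\}$, with coordinate projection $\pi_{J,K}:\mathbb{R}^E\to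 O(J,K)$. $Y_M$ has the polyhedral structure $\mathcal Y_M$ whose faces are the closures of the cones $\pi_{J,K}(\sigma)$, $\sigma\in\Sigma_M^+$, $\sigma\cap\operatorname{relint}(\eta_{J,K})\neq\varnothing$. For a face $\tau$ let $O(\tau)$ be the orbit containing $\operatorname{relint}(\tau)$, $\langle\tau\rangle\subseteq O(\tau)$ its linear span, and $\mathbf F_p(\tau)=\sum_{\delta\supseteq\tau,\ O(\delta)=O(\tau)}\bigwedge^p\langle\delta\rangle$. **Tropical varieties.** Let $Y$ be an extended polyhedral space with polyhedral structure $\mathcal Y$. The tropical Borel–Moore homology $\operatorname{H}^{\mathrm{BM}}_{p,q}(Y)$ is the $q$-th homology of $C^{\mathrm{BM}}_{p,q}(\mathcal Y)=\bigoplus_{|\sigma|=q}\mathbf F_p(\sigma)$ (over all faces of dimension $q$), with boundary the signed sum over codimension-one faces $\tau\subset\sigma$ of the maps $\mathbf F_p(\sigma)\to\mathbf F_p(\tau)$ induced by the projections $O(\sigma)\to O(\tau)$ (identity if the orbits agree). If $Y$ has pure dimension $d$, then $C^{\mathrm{BM}}_{d,d}(\mathcal Y)=\bigoplus_{\eta\in\mathcal Y_d}\bigwedge^d\langle\eta\rangle$, where $\mathcal Y_d$ is the set of $d$-dimensional faces; choosing generators $\nu_\eta$ of $\bigwedge^d\langle\eta\rangle$, any element is $\sum_{\eta}\omega(\eta)\nu_\eta$ with $\omega:\mathcal Y_d\to\mathbb{R}$. $Y$ is a tropical variety (with fundamental class $\nu_Y$) if it is connected, of pure dimension $d$ for some $d$,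 and there is $\nu_Y=\sum_\eta\omega(\eta)\nu_\eta\in C^{\mathrm{BM}}_{d,d}(\mathcal Y)$ that is a cycle, i.e. $\nu_Y\in\operatorname{H}^{\mathrm{BM}}_{d,d}(Y)$, with $\omega$ nowhere vanishing. This does not depend on $\mathcal Y$. *)

(* Defs.v *)
From HB Require Import structures.
From mathcomp Require Import all_boot all_order all_algebra.

Set Implicit Arguments.
Unset Strict Implicit.
Unset Printing Implicit Defensive.

Record matroid (E : finType) := Matroid {
  indep : pred {set E};
  indep_set0 : indep set0;
  indep_sub : forall I J : {set E}, I \subset J -> indep J -> indep I;
  indep_aug : forall I J : {set E}, indep I -> indep J -> (#|I| < #|J|)%N ->
    exists2 x, x \in J :\: I & indep (x |: I)
}.

Section MatroidTheory.
Local Open Scope set_scope.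
Variables (E : finType) (M : matroid E).
Implicit Types (S B F I : {set E}).

Definition mrank S : nat := \max_(I : {set E} | (I \subset S) && indep M I) #|I|.

Definition flat F : bool := [forall x, (x \notin F) ==> (mrank F < mrank (x |: F))%N].

Definition loops : {set E} := [set x | ~~ indep M [set x]].

Definition basis_in S B : bool :=
  [&& B \subset S, indep M B & [forall x in S, indep M (x |: B) ==> (x \in B)]].

Lemma basis_in_card S B I :
  basis_in S B -> I \subset S -> indep M I -> (#|I| <= #|B|)%N.
Proof.
case/and3P=> BS iB /forall_inP maxB IS iI; rewrite leqNgt; apply/negP => ltBI.
have [x /setDP[xI xB] ixB] := indep_aug iB iI ltBI.
by move: (maxB x (subsetP IS x xI)); rewrite ixB (negPf xB).
Qed.

Lemma basis_in_exists S : exists B, basis_in S B.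
Proof.
pose P B := (B \subset S) && indep M B.
have P0 : P set0 by rewrite /P sub0set indep_set0.
exists [arg max_(B > set0 | P B) #|B|].
case: arg_maxnP => // B /andP[BS iB] maxB.
apply/and3P; split=> //; apply/forall_inP => x xS; apply/implyP => ixB.
apply: contraT => xB.
have := maxB (x |: B); rewrite cardsU1 xB /P ixB subUset BS sub1set xS.
by move=> /(_ isT); rewrite /= add1n ltnn.
Qed.

Section Contraction.
Variable S : {set E}.
Let T : finType := {x : E | x \notin S}.

Definition contraction_indep (I : {set T}) : bool :=
  [exists B, basis_in S B && indep M ([set val x | x in I] :|: B)].

Lemma contraction_indep_set0 : contraction_indep set0.
Proof.
have [B bB] := basis_in_exists S; apply/existsP; exists B.
by rewrite bB imset0 set0U; case/and3P: bB.
Qed.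

Lemma contraction_indep_sub (I J : {set T}) :
  I \subset J -> contraction_indep J -> contraction_indep I.
Proof.
move=> IJ /existsP[B /andP[bB iJB]]; apply/existsP; exists B; rewrite bB /=.
by apply: indep_sub iJB; apply: setSU; apply: imsetS.
Qed.

Lemma contraction_indep_aug (I J : {set T}) :
  contraction_indep I -> contraction_indep J -> (#|I| < #|J|)%N ->
  exists2 x, x \in J :\: I & contraction_indep (x |: I).
Proof.
move=> /existsP[B /andP[bB iIB]] /existsP[C /andP[bC iJC]] ltIJ.
have cardU (K : {set T}) D : basis_in S D ->
    #|[set val x | x in K] :|: D| = (#|K| + #|D|)%N.
  case/and3P=> DS _ _; rewrite cardsU card_imset; last exact: val_inj.
  suff -> : [set val x | x in K] :&: D = set0 by rewrite cards0 subn0.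
  apply/setP => y; rewrite !inE; apply/negP => /andP[/imsetP[x _ ->]].
  by move=> /(subsetP DS); rewrite (negPf (valP x)).
have eqBC : #|B| = #|C|.
  apply/eqP; rewrite eqn_leq; case/and3P: (bB) => BS iB _.
  by case/and3P: (bC) => CS iC _; rewrite !(basis_in_card bB, basis_in_card bC).
have := indep_aug iIB iJC; rewrite !cardU// eqBC ltn_add2r => /(_ ltIJ).
case=> y /setDP[]; rewrite !in_setU negb_or => yJC /andP[yI yB] iy.
have yS : y \notin S.
  apply/negP => yS; case/and3P: bB => _ _ /forall_inP/(_ y yS).
  rewrite (negPf yB) implybF => /negP; apply; apply: indep_sub iy.
  by apply: setUS; apply: subsetUr.
have yJ : y \in [set val x | x in J].
  case/orP: yJC => // yC; case/and3P: bC => /subsetP/(_ y yC).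
  by rewrite (negPf yS).
case/imsetP: yJ => x xJ yx; rewrite {y}yx in yI yB iy yJC yS *.
exists x; first by rewrite inE xJ andbT; apply: contra yI; apply: imset_f.
apply/existsP; exists B; rewrite bB /=.
by rewrite imsetU1 -setUA.
Qed.

Definition matroid_contraction : matroid T :=
  Matroid contraction_indep_set0 contraction_indep_sub contraction_indep_aug.

End Contraction.

End MatroidTheory.

From mathcomp Require Import all_classical all_reals all_analysis.

Import Order.TTheory GRing.Theory Num.Theory.
Import numFieldNormedType.Exports.

Local Open Scope classical_set_scope.
Local Open Scope ring_scope.

Section LinearSpan.
Variables (K : fieldType) (vT : vectType K).
Implicit Types (S : set vT) (W : {vspace vT}).

Definition lspan S : {vspace vT} :=
  xget 0%VS [set W : {vspace vT} | (forall v, S v -> v \in W) /\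
                     (forall W' : {vspace vT}, (forall v, S v -> v \in W') -> (W <= W')%VS)].

Lemma lspanP S : (forall v, S v -> v \in lspan S) /\
  (forall W : {vspace vT}, (forall v, S v -> v \in W) -> (lspan S <= W)%VS).
Proof.
apply: (@xgetPex _ 0%VS [set W : {vspace vT} | (forall v, S v -> v \in W) /\
                     (forall W' : {vspace vT}, (forall v, S v -> v \in W') -> (W <= W')%VS)]).
pose P n := `[< exists2 W : {vspace vT}, forall v, S v -> v \in W & \dim W = n >].
have exP : exists n, P n.
  by exists (\dim {:vT}); apply/asboolP; exists fullv => // v _; rewrite memvf.
case: (ex_minnP exP) => n /asboolP[W SW dW] minn; exists W; split=> // W' SW'.
have : P (\dim (W :&: W')).
  apply/asboolP; exists (W :&: W')%VS => // v Sv.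
  by rewrite memv_cap SW ?SW'.
move=> /minn; rewrite -dW => le.
have /eqP <- : (W :&: W' == W)%VS.
  by rewrite eqEdim capvSl.
exact: capvSr.
Qed.

End LinearSpan.

Section Ambient.
Variables (R : realType) (E : finType).

Local Notation V := {ffun E -> R^o}.
Implicit Types (J K S : {set E}).

(* [\bar R] carries the order topology. *)
Definition TP1 : topologicalType := prod_topology (fun _ : E => \bar R).

Definition evec S : V := [ffun i => (i \in S)%:R].

Definition cone (I : finType) (A : {set I}) (v : I -> V) : set V :=
  [set x | exists2 c : I -> R, (forall i, 0 <= c i) &
           x = \sum_(i in A) c i *: v i].

Definition relint (C : set V) : set V :=
  [set x | C x /\ exists2 e : R, 0 < e &
    forall y : V, y - x \in lspan [set z - x | z in C] ->
      (forall i, `|y i - x i| < e) -> C y].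

Definition eta J K : set V :=
  [set x + y | x in cone J (fun j => evec [set j]) &
               y in cone K (fun k => - evec [set k])].

(* O(J,K) is identified with the linear subspace of R^E of the vectors that
   vanish on J :|: K; the projection R^E -> O(J,K) becomes [orbit_proj J K]. *)
Definition orbit_proj J K (x : V) : V :=
  [ffun i => if i \in J :|: K then 0 else x i].

Definition orbit_embed J K (x : V) : TP1 :=
  fun i => if i \in J then +oo%E else if i \in K then -oo%E else (x i)%:E.

(* The face is the closure of the cone [face_cone] of the orbit
   O(face_pos, face_neg). The closure determines the orbit and the cone when
   the cone is closed. *)
Record face := Face {
  face_pos : {set E};
  face_neg : {set E};
  face_cone : set V
}.

HB.instance Definition _ := gen_eqMixin face.
HB.instance Definition _ := gen_choiceMixin face.

Implicit Types (s t : face) (P : set face).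

Definition face_pts t : set TP1 :=
  closure (orbit_embed (face_pos t) (face_neg t) @` face_cone t).

Definition face_span t : {vspace V} := lspan (face_cone t).

Definition face_dim t : nat := \dim (face_span t).

Definition same_orbit s t : Prop :=
  face_pos s = face_pos t /\ face_neg s = face_neg t.

Definition facet t s : Prop :=
  face_pts t `<=` face_pts s /\ face_dim s = (face_dim t).+1.

(* The p-th exterior power of R^E is realized as the alternating tensors:
   the (i_1, ..., i_p) coordinate of v_1 /\ ... /\ v_p is det (v_a (i_b)). *)
Definition ext (p : nat) := {ffun {ffun 'I_p -> E} -> R^o}.

Definition wedge p (v : 'I_p -> V) : ext p :=
  [ffun i : {ffun 'I_p -> E} => \det (\matrix_(a < p, b < p) (v a (i b) : R))].

Definition ext_pow p (U : {vspace V}) : {vspace ext p} :=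
  lspan [set wedge v | v in [set v : 'I_p -> V | forall a, v a \in U]].

(* The map induced by [orbit_proj J K] on p-th exterior powers. *)
Definition ext_proj p J K (w : ext p) : ext p :=
  [ffun i : {ffun 'I_p -> E} =>
     if [exists b, i b \in J :|: K] then 0 else w i].

Lemma ext_proj_wedge p J K (v : 'I_p -> V) :
  ext_proj J K (wedge v) = wedge (fun a => orbit_proj J K (v a)).
Proof.
apply/ffunP => i; rewrite !ffunE; case: ifPn => [/existsP[b ib]|/existsPn noti].
  rewrite (expand_det_col _ b) big1 // => a _.
  by rewrite !mxE ffunE ib mul0r.
congr (\det _); apply/matrixP => a b; rewrite !mxE ffunE.
by rewrite (negPf (noti b)).
Qed.

Lemma ext_proj_linear p J K : linear (@ext_proj p J K).
Proof.
move=> a u v; apply/ffunP => i; rewrite !ffunE; case: ifP => // _.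
by rewrite scaler0 addr0.
Qed.

(* The space F_p(t), a subspace of the p-th exterior power of R^E. *)
Definition multi_tangent P p t : {vspace ext p} :=
  \big[@addv _ _/0%VS]_(s \in [set s | P s /\ same_orbit s t /\
                                     face_pts t `<=` face_pts s])
    ext_pow p (face_span s).

(* Outward normal directions of the codimension-one face [t] of [s]. When the
   orbits differ, the point of [s] goes to O(t) along such a direction. *)
Definition outward s t (u : V) : Prop :=
  (same_orbit s t -> face_cone s (- u) /\ u \notin face_span t) /\
  (~ same_orbit s t -> face_cone s u /\
     relint (eta (face_pos t :\: face_pos s) (face_neg t :\: face_neg s)) u).

(* Incidence numbers, each face [s] being oriented by [vbasis (face_span s)].
   The orientation of [t] is lifted to <s> and preceded by an outward
   direction, then compared with that of [s]; the sign depends on neither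
   the direction nor the lift. *)
Definition incidence s t : R :=
  xget 0 [set e : R | exists u (w : seq V),
    [/\ outward s t u,
        {subset w <= face_span s},
        map (orbit_proj (face_pos t) (face_neg t)) w =
          vbasis (face_span t) :> seq V &
        e = Num.sg (\det (\matrix_(i < face_dim s, j < face_dim s)
              (coord (vbasis (face_span s)) j (nth 0 (u :: w) i) : R)))]].

Definition cells P (q : nat) : set face := [set s | P s /\ face_dim s = q].

Definition BM_chain P p q (c : face -> ext p) : Prop :=
  (forall s, cells P q s -> c s \in multi_tangent P p s) /\
  (forall s, ~ cells P q s -> c s = 0).

Definition BM_boundary P p q (c : face -> ext p) (t : face) : ext p :=
  if `[< P t /\ (face_dim t).+1 = q >] then
    \sum_(s \in [set s | cells P q s /\ facet t s])
      incidence s t *: ext_proj (face_pos t) (face_neg t) (c s)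
  else 0.

Definition BM_cycle P p q (c : face -> ext p) : Prop :=
  BM_chain P q c /\ forall t, BM_boundary P q c t = 0.

Definition pure_dimensional P (d : nat) : Prop :=
  forall t, P t ->
    (forall s, P s -> face_pts t `<=` face_pts s -> s = t) -> face_dim t = d.

Definition fundamental_class P (d : nat) (nu : face -> ext d) (w : face -> R) :
    Prop :=
  [/\ forall s, cells P d s -> ext_pow d (face_span s) = <[nu s]>%VS,
      forall s, cells P d s -> w s != 0 &
      BM_cycle P d (fun s => if `[< cells P d s >] then w s *: nu s else 0)].

(* [P] is presupposed to be a polyhedral structure on [Y]: of its axioms, only
   finiteness and covering are repeated here. *)
Definition tropical_variety (Y : set TP1) P : Prop :=
  [/\ finite_set P,
      Y = \bigcup_(t in P) face_pts t,
      connected Y &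
      exists d, pure_dimensional P d /\
        exists (nu : face -> ext d) (w : face -> R), fundamental_class P nu w].

End Ambient.

Section Schubert.
Variable R : realType.

Definition compatible (E : finType) (M : matroid E) (I : {set E})
    (Fs : {set {set E}}) : bool :=
  [&& indep M I,
      [forall F in Fs, [&& flat M F, F != [set: E]%SET & I \subset F]] &
      [forall F in Fs, [forall G in Fs, (F \subset G) || (G \subset F)]]].

Definition augmented_cone (E : finType) (I : {set E}) (Fs : {set {set E}}) :
    set {ffun E -> R^o} :=
  [set x + y | x in cone I (fun i => @evec R E [set i]%SET) &
               y in cone Fs (fun F => - @evec R E (~: F)%SET)].

Definition loopless_augmented_fan (E : finType) (M : matroid E) :
    set (set {ffun E -> R^o}) :=
  [set C | exists I Fs, compatible M I Fs /\ C = augmented_cone I Fs].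

Definition extend0 (E : finType) (L : {set E})
    (x : {ffun {e : E | e \notin L} -> R^o}) : {ffun E -> R^o} :=
  [ffun e => if insub e is Some e' then x e' else 0].

(* For loopless [M] the contraction is [M] itself, up to the identification of
   E with {e | e \notin set0}. *)
Definition augmented_fan (E : finType) (M : matroid E) :
    set (set {ffun E -> R^o}) :=
  [set @extend0 E (loops M) @` C |
     C in loopless_augmented_fan (matroid_contraction M (loops M))].

Definition fan_support (E : finType) (M : matroid E) : set {ffun E -> R^o} :=
  \bigcup_(C in augmented_fan M) C.

Definition schubert_variety (E : finType) (M : matroid E) : set (TP1 R E) :=
  closure (@orbit_embed R E finset.set0 finset.set0 @` fan_support M).

Definition schubert_structure (E : finType) (M : matroid E) : set (face R E) :=
  [set t | exists (J K : {set E}) (C : set {ffun E -> R^o}),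
     [/\ [disjoint J & K]%B, augmented_fan M C,
         C `&` relint (@eta R E J K) !=set0 &
         t = Face J K (orbit_proj J K @` C)]].

Lemma schubert_structure_finite (E : finType) (M : matroid E) :
  finite_set (schubert_structure M).
Proof.
pose f (x : {set E} * {set E} *
            ({set {e : E | e \notin loops M}} *
             {set {set {e : E | e \notin loops M}}})) :=
  Face x.1.1 x.1.2
    (orbit_proj x.1.1 x.1.2 @` (@extend0 E (loops M) @`
      augmented_cone x.2.1 x.2.2)).
apply: (@sub_finite_set _ _ (range f)); last exact/finite_image/finite_finset.
move=> t [J [K [C [_ [C0 [I [Fs [_ ->]]] <-] _ ->]]]].
by exists ((J, K), (I, Fs)).
Qed.

End Schubert.

Arguments schubert_variety R {E} M.
Arguments schubert_structure R {E} M.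

(* Main.v *)
From HB Require Import structures.
Require Import Defs.
From mathcomp Require Import all_boot all_order all_algebra.
From mathcomp Require Import perm.

(** The variety is the closure of a finite union of cones through the origin, so
    it is connected, and its faces cover it because the face at infinity of a
    cone in a direction [u] of that cone is reached by adding multiples of [u]
    ([orbit_closure_sub], [schubert_varietyE]). The remaining content is the
    purity of the structure and the fundamental class.

    Compatible pairs (I, Fs) form a simplicial complex on the rays e_i and
    - e_(E minus F). Loops play no part in it: the flats of the contraction by
    the loops are the flats of [M] with the loops removed ([augmented_fanP]). Let d be
    the rank of [M]. The flats of a chain have distinct ranks between |I| and
    d - 1, so a pair has at most d rays; a pair with fewer rays skips a rank and
    can be extended ([flagset_extend]). The rays of a pair are linearly
    independent ([ray_sum_eq0]), hence every face lies in one of dimension d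
    ([structure_pure]). The d-dimensional faces are cones in the open orbit:
    elsewhere a direction of the cone has been projected away ([cells_top]).

    The candidate for the fundamental class gives each maximal cone the lattice
    volume form, that is, weight one with respect to its rays. Let t be a face of
    dimension d - 1.

    If t lies at infinity, a cone s having t as a facet contains a ray in the
    kernel of the projection to the orbit of t, so the d-th exterior power of s
    is mapped to zero ([ext_proj_form]). The ray is read off from the coordinates
    of the points of t: the coordinates of the points of s are ordered by the
    chain, and this survives in the closure ([closure_rpart]).

    If t is a cone, the cones having it as a facet arise by adding one ray r
    ([sum_cofacets]), and their contributions are, up to a factor that depends on
    t only, the wedge products of r with t ([incidence_weight]). Their sum is the
    wedge product with t of the sum of the rays r, which vanishes because that
    sum lies in the span of t ([sum_ray_link]). This is the balancing condition,
    and it expresses that the flats covering a flat F partition its complement: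
    if the chain of t skips a rank above cl(I), between F and G, the rays added
    are those of the flats covering F inside G ([link_between]); if it skips
    cl(I), they are the ray of cl(I) and the e_i with i in G but not in cl(I)
    ([link_bottom]). *)

Set Implicit Arguments.
Unset Strict Implicit.
Unset Printing Implicit Defensive.

(** * Rank, closure and flats of a matroid *)

Section MatroidClosure.
Variables (E : finType) (M : matroid E).
Implicit Types (A B F G H I J S : {set E}) (x y : E).

Local Notation rk := (mrank M).

Lemma indep_le_mrank I S : I \subset S -> indep M I -> #|I| <= rk S.
Proof.
by move=> IS iI; apply: (bigmax_sup I) => //; rewrite IS.
Qed.

Lemma mrank_witness S : exists I, [/\ I \subset S, indep M I & #|I| = rk S].
Proof.
have P0 : (set0 \subset S) && indep M set0 by rewrite sub0set indep_set0.
pose P I := (I \subset S) && indep M I.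
rewrite /mrank (@bigmax_eq_arg _ set0 P (fun I => #|I|) P0).
case: arg_maxnP => // I /andP[IS iI] _.
by exists I.
Qed.

Lemma mrankS S A : S \subset A -> rk S <= rk A.
Proof.
move=> SA; have [I [IS iI <-]] := mrank_witness S.
exact/indep_le_mrank/iI/(subset_trans IS).
Qed.

Lemma mrank_indep I : indep M I -> rk I = #|I|.
Proof.
move=> iI; apply/eqP; rewrite eqn_leq (indep_le_mrank (subxx I) iI) andbT.
by have [J [JI _ <-]] := mrank_witness I; apply: subset_leq_card.
Qed.

Lemma indep_extend I S : I \subset S -> indep M I ->
  exists B, [/\ I \subset B, B \subset S, indep M B & #|B| = rk S].
Proof.
move=> IS iI.
have P0 : [&& I \subset I, I \subset S & indep M I] by rewrite subxx IS.
case: (arg_maxnP (P := fun B => [&& I \subset B, B \subset S & indep M B])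
  (fun B => #|B|) P0) => B /and3P[IB BS iB] maxB.
exists B; split=> //; apply/eqP; rewrite eqn_leq (indep_le_mrank BS iB) /=.
rewrite leqNgt; apply/negP => ltB.
have [J [JS iJ cJ]] := mrank_witness S; rewrite -cJ in ltB.
have [x /setDP[xJ xB] ixB] := indep_aug iB iJ ltB.
have := maxB (x |: B); rewrite /= ixB subUset sub1set (subsetP JS x xJ) BS.
by rewrite (subset_trans IB) ?subsetUr // cardsU1 xB add1n ltnn => /(_ isT).
Qed.

Lemma mrankU1 x S : rk (x |: S) <= (rk S).+1.
Proof.
have [I [IS iI <-]] := mrank_witness (x |: S).
have -> : #|I| = ((x \in I) + #|I :\ x|)%N by rewrite [LHS](cardsD1 x).
rewrite -add1n leq_add ?leq_b1 //; apply: indep_le_mrank.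
  by apply/subsetP => y /setD1P[yx /(subsetP IS)/setU1P[]// /eqP]; rewrite (negPf yx).
by apply: indep_sub iI; rewrite subD1set.
Qed.

(** If the rank grew, a maximal independent subset of [S] could be augmented by
    an element of [A]. *)
Lemma mrank_spanned S A : S \subset A ->
  (forall x, x \in A -> rk (x |: S) = rk S) -> rk A = rk S.
Proof.
move=> SA spanA; apply/eqP; rewrite eqn_leq (mrankS SA) andbT leqNgt.
apply/negP => lt; have [B [BS iB cB]] := mrank_witness S.
have [J [JA iJ cJ]] := mrank_witness A; rewrite -cB -cJ in lt.
have [x /setDP[xJ xB] ixB] := indep_aug iB iJ lt.
have := indep_le_mrank (setUS [set x] BS) ixB.
by rewrite cardsU1 xB spanA ?(subsetP JA) // add1n cB ltnn.
Qed.

(** A maximal independent subset of [S] extends to one of [A]; if [x] could be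
    added to the latter, it could be added to the former. *)
Lemma mrank_spanS x S A : S \subset A -> rk (x |: S) = rk S -> rk (x |: A) = rk A.
Proof.
move=> SA rxS; apply/eqP; rewrite eqn_leq (mrankS (subsetUr _ _)) andbT leqNgt.
apply/negP => lt; have [B [BS iB cB]] := mrank_witness S.
have [C [BC CA iC cC]] := indep_extend (subset_trans BS SA) iB.
have [J [JA iJ cJ]] := mrank_witness (x |: A); rewrite -cC -cJ in lt.
have [y /setDP[yJ yC] iyC] := indep_aug iC iJ lt.
have /setU1P[yx | yA] := subsetP JA y yJ; last first.
  have : y |: C \subset A by rewrite subUset sub1set yA.
  by move/indep_le_mrank/(_ iyC); rewrite cardsU1 yC add1n cC ltnn.
rewrite {y}yx in yC iyC yJ.
have ixB : indep M (x |: B) by apply: indep_sub iyC; apply: setUS.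
have xB : x \notin B by apply: contra yC; apply: (subsetP BC).
have := indep_le_mrank (setUS [set x] BS) ixB.
by rewrite cardsU1 xB add1n cB rxS ltnn.
Qed.

Definition cl S : {set E} := [set x | rk (x |: S) == rk S].

Lemma mem_cl x S : x \in S -> x \in cl S.
Proof. by move=> xS; rewrite inE; apply/eqP; congr mrank; apply/setUidPr; rewrite sub1set. Qed.

Lemma sub_cl S : S \subset cl S.
Proof. by apply/subsetP => x; apply: mem_cl. Qed.

Lemma mrank_cl S : rk (cl S) = rk S.
Proof. by apply: mrank_spanned (sub_cl S) _ => x; rewrite inE => /eqP. Qed.

Lemma flat_cl S : flat M (cl S).
Proof.
apply/forallP => x; apply/implyP; rewrite inE neq_ltn ltnNge mrankS ?subsetUr //=.
by rewrite mrank_cl => /leq_trans; apply; apply/mrankS/setUS/sub_cl.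
Qed.

Lemma cl_sub_flat S F : flat M F -> S \subset F -> cl S \subset F.
Proof.
move=> /forallP fF SF; apply/subsetP => x; rewrite inE => /eqP rxS.
apply: contraT => xF; have := implyP (fF x) xF.
by rewrite (mrank_spanS SF rxS) ltnn.
Qed.

Lemma flat_mrank_lt F G : flat M F -> F \proper G -> rk F < rk G.
Proof.
move=> /forallP fF /properP[FG [x xG xF]].
by apply: leq_trans (implyP (fF x) xF) _; apply: mrankS; rewrite subUset sub1set xG.
Qed.

Lemma flat_mrank_ltT F : flat M F -> F != setT -> rk F < rk setT.
Proof. by move=> fF FT; apply: flat_mrank_lt => //; rewrite properEneq FT subsetT. Qed.

Lemma flat_eq F G : flat M F -> F \subset G -> rk G <= rk F -> F = G.
Proof.
move=> fF FG le; apply/eqP; move: FG; rewrite subEproper => /orP[//|].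
by move/(flat_mrank_lt fF); rewrite ltnNge le.
Qed.

Lemma mrank_clU1 x F : flat M F -> x \notin F -> rk (cl (x |: F)) = (rk F).+1.
Proof.
move=> /forallP fF xF; apply/eqP; rewrite mrank_cl eqn_leq mrankU1.
exact: implyP (fF x) xF.
Qed.

Lemma indep_clP x I : indep M I -> x \notin I -> indep M (x |: I) = (x \notin cl I).
Proof.
move=> iI xI; rewrite inE (mrank_indep iI); apply/idP/idP => [ixI|].
  by rewrite (mrank_indep ixI) cardsU1 xI add1n gtn_eqF.
have := indep_le_mrank (subsetUr [set x] I) iI.
have [J [JI iJ <-]] := mrank_witness (x |: I) => leIJ neq.
suff <- : J = x |: I by [].
by apply/eqP; rewrite eqEcard JI cardsU1 xI add1n ltn_neqAle eq_sym neq.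
Qed.

End MatroidClosure.

(** * Compatible pairs as a simplicial complex *)

Section Flags.
Variables (E : finType) (M : matroid E).
Implicit Types (A B F G H I J : {set E}) (i j x y : E).
Implicit Types (S : {set E + {set E}}) (r : E + {set E}).

Local Notation rk := (mrank M).
Local Notation d := (mrank M setT).

Definition lpart S : {set E} := [set i | inl i \in S].
Definition rpart S : {set {set E}} := [set F | inr F \in S].

(** A compatible pair (I, Fs) is stored as one set of rays, I on the left and Fs
    on the right, so that the pairs form a simplicial complex on the vertex set
    E + {set E}. *)
Definition flagset S : bool := compatible M (lpart S) (rpart S).

Lemma flagsetP S :
  reflect [/\ indep M (lpart S),
      forall F, inr F \in S -> [/\ flat M F, F != setT & lpart S \subset F] &
      forall F G, inr F \in S -> inr G \in S -> (F \subset G) || (G \subset F)]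
    (flagset S).
Proof.
apply: (iffP and3P) => -[iI fS cS]; split=> //.
- by move=> F FS; apply/and3P/(forall_inP fS); rewrite inE.
- by move=> F G FS GS; apply: (forall_inP (forall_inP cS F _)); rewrite inE.
- by apply/forall_inP => F; rewrite inE => /fS/and3P.
- apply/forall_inP => F; rewrite inE => FS; apply/forall_inP => G.
  by rewrite inE; apply: cS.
Qed.

Lemma flagset_indep S : flagset S -> indep M (lpart S).
Proof. by case/flagsetP. Qed.

Lemma flagset_flat S F : flagset S -> inr F \in S -> flat M F.
Proof. by case/flagsetP => _ fS _ /fS[]. Qed.

Lemma flagset_proper S F : flagset S -> inr F \in S -> F != setT.
Proof. by case/flagsetP => _ fS _ /fS[]. Qed.

Lemma flagset_lpart S F : flagset S -> inr F \in S -> lpart S \subset F.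
Proof. by case/flagsetP => _ fS _ /fS[]. Qed.

Lemma flagset_chain S F G : flagset S -> inr F \in S -> inr G \in S ->
  (F \subset G) || (G \subset F).
Proof. by case/flagsetP => _ _; apply. Qed.

Lemma lpartU1l i S : lpart (inl i |: S) = i |: lpart S.
Proof. by apply/setP => j; rewrite !inE. Qed.

Lemma lpartU1r F S : lpart (inr F |: S) = lpart S.
Proof. by apply/setP => j; rewrite !inE. Qed.

Lemma card_flag S : #|S| = (#|lpart S| + #|rpart S|)%N.
Proof.
have eS : S = (inl @: lpart S) :|: (inr @: rpart S).
  apply/setP => -[i|F]; rewrite !inE.
  - rewrite mem_imset ?inE; last by move=> ? ? [].
    by case: imsetP => [[]//|]; rewrite orbF.
  - rewrite mem_imset ?inE; last by move=> ? ? [].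
    by case: imsetP => [[]//|].
have -> : #|S| = #|(inl @: lpart S) :|: (inr @: rpart S)| by rewrite -eS.
rewrite cardsU (_ : _ :&: _ = set0) ?cards0 ?subn0; last first.
  apply/setP => -[i|F]; rewrite !inE; last by case: imsetP => [[]//|].
  by case: (imsetP (f := inr)) => [[]//|]; rewrite andbF.
by rewrite !card_imset // => ? ? [].
Qed.

Lemma flagsetS S' S : S' \subset S -> flagset S -> flagset S'.
Proof.
move=> /subsetP sS fS; have lS : lpart S' \subset lpart S.
  by apply/subsetP => i; rewrite !inE => /sS.
apply/flagsetP; split=> [|F /sS FS|F G /sS FS /sS GS].
- exact: indep_sub lS (flagset_indep fS).
- split; [exact: flagset_flat FS|exact: flagset_proper FS|].
  exact: subset_trans lS (flagset_lpart fS FS).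
- exact: flagset_chain fS FS GS.
Qed.

Lemma flagset_addl S i : flagset S -> indep M (i |: lpart S) ->
  (forall F, inr F \in S -> i \in F) -> flagset (inl i |: S).
Proof.
move=> fS ii iF; apply/flagsetP; rewrite lpartU1l; split=> [//|F|F G].
- rewrite !inE /= => FS; rewrite subUset sub1set (iF F FS) (flagset_lpart fS FS).
  by split=> //; [exact: flagset_flat fS FS | exact: flagset_proper fS FS].
- by rewrite !inE /=; apply: flagset_chain.
Qed.

Lemma flagset_addr S H : flagset S -> flat M H -> H != setT -> lpart S \subset H ->
  (forall F, inr F \in S -> (F \subset H) || (H \subset F)) -> flagset (inr H |: S).
Proof.
move=> fS fH HT IH cH; apply/flagsetP; rewrite lpartU1r; split.
- exact: flagset_indep.
- move=> F /setU1P[[->]//|FS].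
  split; [exact: flagset_flat fS FS|exact: flagset_proper fS FS|].
  exact: flagset_lpart fS FS.
- move=> F G /setU1P[[->]|FS] /setU1P[[->]|GS].
  + by rewrite subxx.
  + by rewrite orbC cH.
  + exact: cH.
  + exact: flagset_chain fS FS GS.
Qed.

Lemma flagset_mrank_inj S F G : flagset S -> inr F \in S -> inr G \in S ->
  rk F = rk G -> F = G.
Proof.
move=> fS FS GS eqr; case/orP: (flagset_chain fS FS GS) => [FG|GF].
  exact: flat_eq (flagset_flat fS FS) FG (eq_leq (esym eqr)).
exact/esym/(flat_eq (flagset_flat fS GS) GF (eq_leq eqr)).
Qed.

Let ranks S := [seq rk F | F <- enum (rpart S)].

Lemma flagset_ranks S : flagset S ->
  uniq (ranks S) /\ {subset ranks S <= iota #|lpart S| (d - #|lpart S|)}.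
Proof.
move=> fS; split.
  rewrite map_inj_in_uniq ?enum_uniq // => F G.
  by rewrite !mem_enum !inE; apply: flagset_mrank_inj.
move=> k /mapP[F]; rewrite mem_enum inE => FS ->.
rewrite mem_iota -(mrank_indep (flagset_indep fS)) mrankS ?(flagset_lpart fS) //=.
rewrite subnKC ?mrankS ?subsetT // flat_mrank_ltT //.
  exact: flagset_flat FS.
exact: flagset_proper FS.
Qed.

Lemma lpart_leq S : flagset S -> #|lpart S| <= d.
Proof. by move=> fS; rewrite -(mrank_indep (flagset_indep fS)) mrankS ?subsetT. Qed.

(** The flats of the chain have distinct ranks between |I| and d - 1. *)
Lemma flagset_leq S : flagset S -> #|S| <= d.
Proof.
move=> fS; have [uS sS] := flagset_ranks fS; have := uniq_leq_size uS sS.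
by rewrite size_map size_iota -cardE card_flag leq_subRL ?lpart_leq.
Qed.

Lemma flagset_full_ranks S k : flagset S -> #|S| = d -> #|lpart S| <= k < d ->
  exists2 F, inr F \in S & rk F = k.
Proof.
move=> fS cS k_in; have [uS sS] := flagset_ranks fS.
have le : size (iota #|lpart S| (d - #|lpart S|)) <= size (ranks S).
  by rewrite size_map size_iota -cardE -cS card_flag addKn.
have [_ eqm] := uniq_min_size uS sS le.
have : k \in ranks S by rewrite eqm mem_iota subnKC ?lpart_leq.
by case/mapP => F; rewrite mem_enum inE => FS ->; exists F.
Qed.

(** Successor in the chain, the whole ground set being its last element. *)
Lemma flagset_next S F : flagset S -> inr F \in S ->
  exists G, [/\ G = setT \/ inr G \in S, F \proper G &
    forall A, inr A \in S -> (A \subset F) || (G \subset A)].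
Proof.
move=> fS FS; pose P G := ((G == setT) || (inr G \in S)) && (F \proper G).
have PT : P setT by rewrite /P eqxx properEneq subsetT (flagset_proper fS FS).
case: (arg_minnP (fun G => #|G|) PT) => G /andP[GS FG] minG.
exists G; split=> //; first by case/orP: GS => [/eqP->|]; [left|right].
move=> A AS; case/orP: (flagset_chain fS AS FS) => [->//|FA].
case: (boolP (A \subset F)) => //= nAF.
have PA : P A by rewrite /P AS orbT properE FA.
case/orP: GS => [/eqP GT|GS].
  by have := minG A PA; rewrite GT => le; rewrite -(eqP (_ : A == setT)) // eqEcard subsetT.
case/orP: (flagset_chain fS AS GS) => // AG.
by rewrite (eqP (_ : A == G)) // eqEcard AG minG.
Qed.

(** Witnesses the linear independence of the rays of a chain: a coordinate at
    which the ray of [F] is visible and those of the larger flats are not. *)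
Lemma flagset_separate S F : flagset S -> inr F \in S ->
  exists2 j, j \notin F & forall A, inr A \in S -> F \proper A -> j \in A.
Proof.
move=> fS FS; have [G [_ /properP[_ [j jG jF]] sepG]] := flagset_next fS FS.
exists j => // A AS /andP[_ nAF]; have := sepG A AS; rewrite (negPf nAF) /=.
by move/subsetP; apply.
Qed.

Lemma flagset_between S F G H : flagset S -> inr F \in S ->
  (forall A, inr A \in S -> (A \subset F) || (G \subset A)) ->
  flat M H -> H != setT -> F \subset H -> H \subset G -> flagset (inr H |: S).
Proof.
move=> fS FS sepG fH HT FH HG; apply: flagset_addr => //.
  exact: subset_trans (flagset_lpart fS FS) FH.
move=> A AS; case/orP: (sepG A AS) => [AF|GA].
  by rewrite (subset_trans AF).
by rewrite (subset_trans HG) ?orbT.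
Qed.

Lemma flagset_addcl S : flagset S -> #|lpart S| < d -> flagset (inr (cl M (lpart S)) |: S).
Proof.
move=> fS lt; apply: flagset_addr; rewrite ?flat_cl ?sub_cl //.
  apply: contraTneq lt => eqT.
  by rewrite -leqNgt -(mrank_indep (flagset_indep fS)) -(mrank_cl M (lpart S)) eqT.
move=> F FS; apply/orP; right; apply: cl_sub_flat (flagset_flat fS FS) _.
exact: flagset_lpart fS FS.
Qed.

(** Purity of the complex: if the chain skips a rank, the smallest rank it skips
    can be filled in, by cl(I) or by a flat covering a member of the chain. *)
Lemma flagset_extend S : flagset S -> #|S| < d ->
  exists2 r, r \notin S & flagset (r |: S).
Proof.
move=> fS ltS; have leI := lpart_leq fS.
pose P k := [&& #|lpart S| <= k, k < d & k \notin ranks S].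
have exP : exists k, P k.
  case: (boolP (has P (iota #|lpart S| (d - #|lpart S|)))) => [/hasP[k _ Pk]|].
    by exists k.
  move=> /hasPn nP; move: ltS; rewrite card_flag ltnNge -leq_subLR.
  have sub : {subset iota #|lpart S| (d - #|lpart S|) <= ranks S}.
    move=> k k_in; have := nP k k_in; move: k_in.
    by rewrite mem_iota subnKC // /P => /andP[-> ->] /=; rewrite negbK.
  by have := uniq_leq_size (iota_uniq _ _) sub; rewrite size_map size_iota -cardE => ->.
case: (ex_minnP exP) => k /and3P[lek ltk kS] mink.
have noF F : inr F \in S -> rk F <> k.
  by move=> FS kE; case/negP: kS; rewrite -kE map_f // mem_enum inE.
move: lek; rewrite leq_eqVlt => /orP[/eqP kI|ltI].
  exists (inr (cl M (lpart S))); last by apply: flagset_addcl; rewrite ?kI.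
  by apply/negP => /noF; rewrite mrank_cl (mrank_indep (flagset_indep fS)).
case: k => // k in ltk kS mink noF ltI *.
have [F FS rF] : exists2 F, inr F \in S & rk F = k.
  have : k \in ranks S.
    apply: contraT => kS'; have : P k by rewrite /P kS' (ltnW ltk) -ltnS ltI.
    by move/mink; rewrite ltnn.
  by case/mapP => F; rewrite mem_enum inE => FS ->; exists F.
have fF := flagset_flat fS FS.
have [G [GS /properP[FG [x xG xF]] sepG]] := flagset_next fS FS.
have rH := mrank_clU1 fF xF.
exists (inr (cl M (x |: F))); first by apply/negP => /noF; rewrite rH rF.
apply: (flagset_between fS FS sepG) => //; first exact: flat_cl.
- by apply: contraTneq ltk => HT; rewrite -leqNgt -rF -rH HT.
- by apply: subset_trans (sub_cl _ _); apply: subsetUr.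
- case: GS => [->|GS]; first exact: subsetT.
  by apply: cl_sub_flat (flagset_flat fS GS) _; rewrite subUset sub1set xG.
Qed.

Lemma flagset_bottom S : flagset S ->
  exists G, (G = setT \/ inr G \in S) /\ forall A, inr A \in S -> G \subset A.
Proof.
move=> fS; pose P G := (G == setT) || (inr G \in S).
have PT : P setT by rewrite /P eqxx.
case: (arg_minnP (fun G => #|G|) PT) => G GS minG; exists G.
split=> [|A AS]; first by case/orP: GS => [/eqP|]; [left|right].
have le : #|G| <= #|A| by apply: minG; rewrite /P AS orbT.
case/orP: GS => [/eqP GT|GS].
  by rewrite (eqP (_ : A == setT)) ?subsetT // eqEcard subsetT -GT.
case/orP: (flagset_chain fS AS GS) => // AG.
by rewrite (eqP (_ : A == G)) // eqEcard AG.
Qed.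

Definition link S : {set E + {set E}} := [set r | (r \notin S) && flagset (r |: S)].

(** Here the chain skips cl(I). A flag of size d has a flat of every rank from |I|
    on, so the only flat that can be added is the one of rank |I|. *)
Lemma link_bottom S : flagset S -> #|S|.+1 = d -> inr (cl M (lpart S)) \notin S ->
  exists G, [/\ G = setT \/ inr G \in S, cl M (lpart S) \subset G &
    link S = inr (cl M (lpart S)) |: (inl @: (G :\: cl M (lpart S)))].
Proof.
move=> fS cS clS; have [G [GS subG]] := flagset_bottom fS.
have iI := flagset_indep fS.
have clG : cl M (lpart S) \subset G.
  case: GS => [->|GS]; first exact: subsetT.
  exact: cl_sub_flat (flagset_flat fS GS) (flagset_lpart fS GS).
have ltI : #|lpart S| < d by rewrite -cS ltnS card_flag leq_addr.
exists G; split=> //; apply/setP => -[i|H]; rewrite !inE /=.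
  rewrite mem_imset; last by move=> ? ? [].
  rewrite !inE; apply/andP/andP => [[iS fi]|[icl iG]].
    have := flagset_indep fi; rewrite lpartU1l indep_clP ?inE // => icl.
    split=> //; case: GS => [->|GS]; first by [].
    have GS' : inr G \in inl i |: S by rewrite !inE.
    by apply: (subsetP (flagset_lpart fi GS')); rewrite lpartU1l setU11.
  have iI' : i \notin lpart S by apply: contra icl => /(mem_cl M); rewrite inE.
  split; first by rewrite inE in iI'.
  apply: flagset_addl; rewrite ?indep_clP // ?inE // => A AS.
  exact: subsetP (subG A AS) i iG.
case: imsetP => [[]//|_]; rewrite orbF.
apply/andP/eqP => [[HS fH]|[->]]; last by split=> //; apply: flagset_addcl.
have cH : #|inr H |: S| = d by rewrite cardsU1 HS add1n.
have [|A AS rA] := flagset_full_ranks fH cH (k := #|lpart S|).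
  by rewrite lpartU1r leqnn.
have eqA : cl M (lpart S) = A.
  apply: flat_eq (flat_cl M _) _ _; last by rewrite rA mrank_cl (mrank_indep iI).
  apply: cl_sub_flat (flagset_flat fH AS) _.
  by have := flagset_lpart fH AS; rewrite lpartU1r.
move: AS; rewrite -eqA => /setU1P[[<-]//|]; by rewrite (negPf clS).
Qed.

(** Here no element can be added to I, which spans cl(I) already. A flag of size d
    has a flat of every rank from |I| on, so the flats [Hs] that can be added all
    have the one rank that the chain skips; they cover the member [F] of the chain
    just below, and an element outside [F] spans with it exactly one of them. *)
Lemma link_between S : flagset S -> #|S|.+1 = d -> inr (cl M (lpart S)) \in S ->
  exists F G, [/\ inr F \in S, G = setT \/ inr G \in S, F \subset G &
    exists Hs : {set {set E}}, [/\ link S = inr @: Hs,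
      forall H, H \in Hs -> (F \subset H) && (H \subset G) &
      forall x, x \in G :\: F -> exists2 H, H \in Hs /\ x \in H &
        forall H', H' \in Hs -> x \in H' -> H' = H]].
Proof.
move=> fS cS clS; have iI := flagset_indep fS.
have [r0 r0S fr0] : exists2 r, r \notin S & flagset (r |: S).
  by apply: flagset_extend fS _; rewrite -cS.
have noL i : inl i \notin S -> flagset (inl i |: S) = false.
  move=> iS; apply/negP => fi.
  have := flagset_indep fi; rewrite lpartU1l indep_clP ?inE // => /negP[].
  have clS' : inr (cl M (lpart S)) \in inl i |: S by rewrite !inE.
  have := subsetP (flagset_lpart fi clS') i.
  by rewrite lpartU1l setU11 inE => ->.
case: r0 r0S fr0 => [i|H0] H0S fH0; first by rewrite noL in fH0.
have full H : inr H \notin S -> #|inr H |: S| = d by move=> HS; rewrite cardsU1 HS.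
have ltI : #|lpart S| < rk H0.
  rewrite -(mrank_indep iI) ltn_neqAle mrankS.
    rewrite andbT; apply: contraNneq H0S => eqr.
    suff -> : H0 = cl M (lpart S) by [].
    apply: (flagset_mrank_inj fH0); rewrite ?setU11 // ?inE ?clS ?orbT //.
    by rewrite mrank_cl.
  by have := flagset_lpart fH0 (setU11 _ _); rewrite lpartU1r.
have ltd : rk H0 < d.
  have H0S' : inr H0 \in inr H0 |: S by rewrite setU11.
  exact: flat_mrank_ltT (flagset_flat fH0 H0S') (flagset_proper fH0 H0S').
case: (posnP (rk H0)) => [eq0|]; first by rewrite eq0 in ltI.
case kE: (rk H0) => [//|k] _.
have rkH H : inr H \notin S -> flagset (inr H |: S) -> rk H = k.+1.
  move=> HS fH; have [|A] := flagset_full_ranks fH (full H HS) (k := k.+1).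
    by rewrite lpartU1r -kE (ltnW ltI).
  case/setU1P => [[->]//|AS rA]; case/negP: H0S.
  suff -> : H0 = A by [].
  by apply: (flagset_mrank_inj fH0); rewrite ?setU11 // ?inE ?AS ?orbT // kE.
have [F FS rF] : exists2 F, inr F \in S & rk F = k.
  have [|A] := flagset_full_ranks fH0 (full H0 H0S) (k := k).
    by rewrite lpartU1r -ltnS -kE ltI ltnW // -kE.
  case/setU1P => [[->]|AS]; last by exists A.
  by rewrite kE => /esym/n_Sn.
have fF := flagset_flat fS FS.
have noRk A : inr A \in S -> rk A <> k.+1.
  move=> AS rA; case/negP: H0S; suff -> : H0 = A by [].
  by apply: (flagset_mrank_inj fH0); rewrite ?setU11 // ?inE ?AS ?orbT // kE.
have [G [GS FG sepG]] := flagset_next fS FS.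
exists F, G; split=> //; first exact: proper_sub.
pose Hs := [set H | [&& flat M H, rk H == k.+1, F \subset H & H \subset G]].
have linkE : link S = inr @: Hs.
  apply/setP => -[i|H]; rewrite !inE.
    by case: imsetP => [[]//|_]; apply/negP => /andP[iS]; rewrite noL.
  rewrite mem_imset; last by move=> ? ? [].
  rewrite inE; apply/andP/and4P => [[HS fH]|[fH /eqP rH FH HG]].
    have HS' : inr H \in inr H |: S by rewrite setU11.
    have AS' A : inr A \in S -> inr A \in inr H |: S by rewrite !inE => ->; rewrite orbT.
    split; [exact: flagset_flat fH HS'|by rewrite rkH| |].
      case/orP: (flagset_chain fH (AS' F FS) HS') => // HF.
      by have := mrankS M HF; rewrite rF (rkH H) // ltnn.
    case: GS => [->|GS]; first exact: subsetT.
    case/orP: (flagset_chain fH (AS' G GS) HS') => // GH.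
    have := mrankS M GH; rewrite (rkH H) // => le.
    by case: (noRk G GS); apply/eqP; rewrite eqn_leq le -rF flat_mrank_lt.
  have HS : inr H \notin S by apply/negP => /noRk.
  split=> //; apply: (flagset_between fS FS sepG) => //.
  by apply: contraTneq ltd => HT; rewrite -leqNgt kE -rH HT.
exists Hs; split=> // [H|x /setDP[xG xF]]; first by rewrite inE => /and4P[_ _ -> ->].
have fH := flat_cl M (x |: F); have rH := mrank_clU1 fF xF.
exists (cl M (x |: F)) => [|H'].
  split; last by rewrite mem_cl ?setU11.
  rewrite inE fH rH rF eqxx /= (subset_trans _ (sub_cl _ _)) ?subsetUr //=.
  case: GS => [->|GS]; first exact: subsetT.
  by rewrite cl_sub_flat ?(flagset_flat fS GS) // subUset sub1set xG proper_sub.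
rewrite inE => /and4P[fH' /eqP rH' FH' _] xH'; apply/esym/(flat_eq fH).
  by apply: cl_sub_flat => //; rewrite subUset sub1set xH'.
by rewrite rH rH' rF.
Qed.

End Flags.

(** * Loops *)

Section Loops.
Variables (E : finType) (M : matroid E).

Local Notation L := (loops M).
Local Notation T := {e : E | e \notin loops M}.
Local Notation N := (matroid_contraction M (loops M)).
Implicit Types (I F : {set T}) (G : {set E}).

Lemma indep_loops G x : indep M G -> x \in L -> x \notin G.
Proof.
move=> iG; rewrite inE; apply: contra => xG.
by apply: indep_sub iG; rewrite sub1set.
Qed.

Lemma indep_contraction I : indep N I = indep M [set val x | x in I].
Proof.
have basis0 B : basis_in M L B -> B = set0.
  case/and3P=> BL iB _; apply/eqP; rewrite -subset0; apply/subsetP => x xB.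
  by have := indep_loops iB (subsetP BL x xB); rewrite xB.
apply/existsP/idP => [[B /andP[/basis0->]]|iI]; first by rewrite setU0.
have [B bB] := basis_in_exists M L; exists B.
by rewrite bB (basis0 _ bB) setU0.
Qed.

(** Independent sets avoid the loops. *)
Lemma mrank_loops G : mrank M (G :|: L) = mrank M G.
Proof.
apply: mrank_spanned (subsetUl _ _) _ => x /setUP[|] xG.
  by congr mrank; apply/setUidPr; rewrite sub1set.
apply/eqP; rewrite eqn_leq (mrankS M (subsetUr _ _)) andbT.
have [J [JG iJ <-]] := mrank_witness M (x |: G).
apply: indep_le_mrank => //; apply/subsetP => y yJ.
case/setU1P: (subsetP JG y yJ) => // yx.
by have := indep_loops iJ xG; rewrite -yx yJ.
Qed.

(** The correspondence between the flats of the contraction and those of [M]. *)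
Definition add_loops F : {set E} := [set val x | x in F] :|: L.

Lemma mem_add_loops F (x : T) : (val x \in add_loops F) = (x \in F).
Proof.
by rewrite in_setU (negPf (valP x)) orbF mem_imset //; apply: val_inj.
Qed.

Lemma add_loops_inj : injective add_loops.
Proof. by move=> F F' eqF; apply/setP => x; rewrite -!mem_add_loops eqF. Qed.

Lemma add_loops_subset F F' : (add_loops F \subset add_loops F') = (F \subset F').
Proof.
apply/subsetP/subsetP => [sF x|sF x].
  by rewrite -!mem_add_loops; apply: sF.
case/setUP => [/imsetP[y yF ->]|xL]; first by rewrite mem_add_loops sF.
by rewrite inE xL orbT.
Qed.

Lemma imset_val_add_loops I F :
  ([set val x | x in I] \subset add_loops F) = (I \subset F).
Proof.
apply/subsetP/subsetP => [sF x xI|sF x /imsetP[y yI ->]].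
  by rewrite -mem_add_loops; apply: sF; apply: imset_f.
by rewrite mem_add_loops sF.
Qed.

Lemma add_loopsT F : (add_loops F == setT) = (F == setT).
Proof.
apply/eqP/eqP => [eqT|->]; first by apply/setP => x; rewrite -mem_add_loops eqT !inE.
apply/setP => x; rewrite [RHS]inE; case: (boolP (x \in L)) => xL.
  by rewrite in_setU xL orbT.
by rewrite (mem_add_loops setT (exist (fun e => e \notin L) x xL)) inE.
Qed.

Lemma mrank_contraction F : mrank N F = mrank M (add_loops F).
Proof.
rewrite mrank_loops; apply/eqP; rewrite eqn_leq; apply/andP; split.
  have [I [IF iI <-]] := mrank_witness N F; rewrite indep_contraction in iI.
  rewrite -(card_imset (mem I) val_inj); apply: indep_le_mrank iI.
  exact: imsetS.
have [J [JF iJ <-]] := mrank_witness M [set val x | x in F].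
have JE : J = [set val x | x in [set x : T | val x \in J]].
  apply/setP => y; apply/idP/imsetP => [yJ|[x + ->]]; last by rewrite inE.
  by case/imsetP: (subsetP JF y yJ) => x xF yx; exists x => //; rewrite inE -yx.
rewrite JE card_imset; last exact: val_inj.
apply: indep_le_mrank; last by rewrite indep_contraction -JE.
apply/subsetP => x; rewrite inE => /(subsetP JF)/imsetP[y yF].
by move/val_inj ->.
Qed.

Lemma flat_contraction F : flat N F = flat M (add_loops F).
Proof.
have addU (x : T) : add_loops (x |: F) = val x |: add_loops F.
  by rewrite /add_loops imsetU1 setUA.
apply/forallP/forallP => fF x; apply/implyP => xF; last first.
  by rewrite !mrank_contraction addU (implyP (fF (val x))) // mem_add_loops.
have xL : x \notin L by apply: contra xF => xL; rewrite inE xL orbT.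
pose x' : T := exist (fun e => e \notin L) x xL.
have := fF x'; rewrite -mem_add_loops xF /= !mrank_contraction addU; exact.
Qed.

Lemma loops_flat G : flat M G -> L \subset G.
Proof.
move=> /forallP fG; apply/subsetP => x xL; apply: contraT => xG.
have := implyP (fG x) xG; rewrite -(mrank_loops (x |: G)) -setUA -(mrank_loops G).
rewrite (_ : x |: (G :|: L) = G :|: L) ?ltnn //.
by apply/setUidPr; rewrite sub1set inE xL orbT.
Qed.

Lemma add_loopsK G : L \subset G -> add_loops [set x : T | val x \in G] = G.
Proof.
move=> LG; apply/setP => x; apply/setUP/idP => [[/imsetP[y + ->]|/(subsetP LG)]|xG] //.
  by rewrite inE.
case: (boolP (x \in L)) => xL; [by right|left].
by apply/imsetP; exists (exist (fun e => e \notin L) x xL); rewrite ?inE.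
Qed.

Lemma compatible_contraction I (Fs : {set {set T}}) :
  compatible N I Fs = compatible M [set val x | x in I] (add_loops @: Fs).
Proof.
rewrite /compatible indep_contraction; congr [&& _, _ & _].
- apply/forall_inP/forall_inP => [fF G /imsetP[F FFs ->]|fF F FFs].
    have := fF F FFs.
    by rewrite flat_contraction -add_loopsT imset_val_add_loops.
  have := fF _ (imset_f _ FFs).
  by rewrite flat_contraction add_loopsT imset_val_add_loops.
- apply/forall_inP/forall_inP => [cF _ /imsetP[F FFs ->]|cF F FFs].
    apply/forall_inP => _ /imsetP[G GFs ->]; rewrite !add_loops_subset.
    exact: (forall_inP (cF F FFs)).
  apply/forall_inP => G GFs; rewrite -!add_loops_subset.
  exact: (forall_inP (cF _ (imset_f _ FFs))) _ (imset_f _ GFs).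
Qed.

(** Every compatible pair comes from the contraction, since independent sets
    avoid the loops and flats contain them. *)
Lemma compatible_from_contraction (I : {set E}) (Fs : {set {set E}}) :
  compatible M I Fs -> exists (I' : {set T}) (Fs' : {set {set T}}),
    I = [set val x | x in I'] /\ Fs = add_loops @: Fs'.
Proof.
case/and3P => iI /forall_inP fF _.
exists [set x : T | val x \in I], [set F : {set T} | add_loops F \in Fs]; split.
  apply/setP => x; apply/idP/imsetP => [xI|[y + ->]]; last by rewrite inE.
  have xL : x \notin L by apply: contraL xI; apply: indep_loops.
  by exists (exist (fun e => e \notin L) x xL); rewrite ?inE.
apply/setP => G; apply/idP/imsetP => [GF|[F + ->]]; last by rewrite inE.
have /and3P[/loops_flat LG _ _] := fF G GF.
by exists [set x : T | val x \in G]; rewrite ?inE add_loopsK.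
Qed.

End Loops.

From mathcomp Require Import all_classical all_reals all_analysis.

Import Order.TTheory GRing.Theory Num.Theory.
Import numFieldNormedType.Exports.

Local Open Scope classical_set_scope.
Local Open Scope ring_scope.

(** * Cones of the augmented Bergman fan *)

Section Rays.
Variables (R : realType) (E : finType).
Local Notation V := {ffun E -> R^o}.
Local Notation ray_index := (E + {set E})%type.
Implicit Types (S : {set ray_index}) (r : ray_index) (x y : V) (c : ray_index -> R).

Definition ray r : V :=
  match r with inl i => evec R [set i]%SET | inr F => - evec R (~: F)%SET end.

Lemma ray_inl i j : ray (inl i) j = (j == i)%:R.
Proof. by rewrite ffunE inE. Qed.

Lemma ray_inr F j : ray (inr F) j = - (j \notin F)%:R.
Proof. by rewrite !ffunE inE. Qed.

Lemma ray_sum_coord S c j :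
  (\sum_(r in S) c r *: ray r) j =
    (if j \in lpart S then c (inl j) else 0)
      - \sum_(F in rpart S | j \notin F) c (inr F).
Proof.
rewrite sum_ffunE big_sumType /=; congr (_ + _).
  under eq_bigr do rewrite ffunE ray_inl.
  case: ifPn; rewrite inE => jS.
    rewrite (bigD1 j) //= eqxx [_ *: _]mulr1 big1 ?addr0 // => i /andP[_ ij].
    by rewrite eq_sym (negPf ij) [_ *: _]mulr0.
  rewrite big1 // => i iS; case: eqP => [ji|]; last by rewrite [_ *: _]mulr0.
  by rewrite ji iS in jS.
rewrite -sumrN big_mkcondr /=; apply: eq_big => [F|F _]; first by rewrite inE.
rewrite ffunE ray_inr; case: ifP => _; first by rewrite [_ *: _]mulrN1.
by rewrite oppr0 [_ *: _]mulr0.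
Qed.

Lemma cone_ray_in S r : r \in S -> cone S ray (ray r).
Proof.
move=> rS; exists (fun r' => (r' == r)%:R) => [?|]; first exact: ler0n.
rewrite (bigD1 r) //= eqxx scale1r big1 ?addr0 // => r' /andP[_ /negPf->].
by rewrite scale0r.
Qed.

Lemma cone_in0 S : cone S ray 0.
Proof. by exists (fun=> 0) => // ; rewrite big1 // => r _; rewrite scale0r. Qed.

Lemma cone_inD S x y : cone S ray x -> cone S ray y -> cone S ray (x + y).
Proof.
move=> [a a0 ->] [b b0 ->]; exists (fun r => a r + b r) => [r|].
  exact: addr_ge0.
by rewrite -big_split /=; apply: eq_bigr => r _; rewrite scalerDl.
Qed.

Lemma cone_inZ S (t : R) x : 0 <= t -> cone S ray x -> cone S ray (t *: x).
Proof.
move=> t0 [a a0 ->]; exists (fun r => t * a r) => [r|]; first exact: mulr_ge0.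
by rewrite scaler_sumr; apply: eq_bigr => r _; rewrite scalerA.
Qed.

Lemma coneS S' S : S' \subset S -> cone S' ray `<=` cone S ray.
Proof.
move=> sS x [c c0 ->]; exists (fun r => if r \in S' then c r else 0) => [r|].
  by case: ifP.
rewrite [RHS](big_setID S') /= (finset.setIidPr sS) [X in _ = _ + X]big1 ?addr0.
  by apply: eq_bigr => r ->.
by move=> r /finset.setDP[_ /negPf->]; rewrite scale0r.
Qed.

Lemma coneU1 r S x : r \notin S -> cone (r |: S)%SET ray x ->
  exists2 t, 0 <= t & exists2 y, cone S ray y & x = t *: ray r + y.
Proof.
move=> rS [c c0 ->]; exists (c r) => //; rewrite big_setU1 //=.
by exists (\sum_(r in S) c r *: ray r) => //; exists c.
Qed.

Section Inequalities.
Variables (M : matroid E) (S : {set ray_index}).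
Hypothesis fS : flagset M S.

Lemma cone_ge0 x j : (forall F, inr F \in S -> j \in F) ->
  cone S ray x -> 0 <= x j.
Proof.
move=> jF [c c0 ->]; rewrite ray_sum_coord big1 ?subr0; first by case: ifP.
by move=> F; rewrite inE => /andP[FS /negPf]; rewrite jF.
Qed.

Lemma cone_le0 x j : j \notin lpart S -> cone S ray x -> x j <= 0.
Proof.
move=> /negPf jI [c c0 ->]; rewrite ray_sum_coord jI sub0r oppr_le0.
exact: sumr_ge0.
Qed.

(** The coordinates outside I are constant on the steps of the chain and decrease
    from each step to the next. Together with the two inequalities above, this is
    all that is remembered of a cone when passing to its closure. *)
Lemma cone_le x j k : j \notin lpart S ->
  (forall F, inr F \in S -> k \notin F -> j \notin F) ->
  cone S ray x -> x j <= x k.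
Proof.
move=> jI jk Cx; case: (boolP (k \in lpart S)) => kI.
  rewrite (le_trans (cone_le0 jI Cx)) // (cone_ge0 _ Cx) // => F FS.
  exact: fintype.subsetP (flagset_lpart fS FS) k kI.
case: Cx => c c0 ->; rewrite !ray_sum_coord (negPf jI) (negPf kI) !sub0r lerN2.
rewrite [leRHS](bigID (fun F : {set E} => k \notin F)) /=.
under [X in _ <= X + _]eq_bigl do rewrite -andbA.
rewrite (_ : \sum_(i in _ | _) _ =
    \sum_(i in rpart S | (j \notin i) && (k \notin i)) c (inr i)).
  by rewrite lerDl sumr_ge0.
apply: eq_bigl => F; rewrite inE; case: (boolP (inr F \in S)) => //= FS.
by case: (boolP (k \notin F)) => [/(jk F FS)->|]; rewrite ?andbF.
Qed.

End Inequalities.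

(** A relation between the rays is tested at the coordinate separating the
    smallest flat that occurs in it from the larger ones. *)
Lemma ray_sum_eq0 (M : matroid E) S c : flagset M S ->
  \sum_(r in S) c r *: ray r = 0 -> forall r, r \in S -> c r = 0.
Proof.
move=> fS sum0.
have cF F : inr F \in S -> c (inr F) = 0.
  move=> FS; apply/eqP; apply: contraT => cF.
  pose P F := (inr F \in S) && (c (inr F) != 0).
  have PF : P F by rewrite /P FS.
  case: (arg_minnP (fun F : {set E} => #|F|) PF) => {cF FS PF}F /andP[FS cF] minF.
  have [j jF sepj] := flagset_separate fS FS.
  have := congr1 (fun x : V => x j) sum0; rewrite ray_sum_coord ffunE.
  rewrite ifF; last first.
    by apply: contraNF jF; apply: fintype.subsetP (flagset_lpart fS FS) j.
  rewrite (bigD1 F) ?inE ?FS //= big1 => [|G].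
    by move/eqP; rewrite addr0 sub0r oppr_eq0 (negPf cF).
  rewrite inE => /andP[/andP[GS jG] GF]; apply/eqP; apply: contraT => cG.
  have le : (#|F| <= #|G|)%N by apply: minF; rewrite /P GS.
  case/orP: (flagset_chain fS FS GS) => sub.
    by rewrite (sepj G) // in jG; rewrite finset.properEneq eq_sym GF.
  by case/eqP: GF; apply/eqP; rewrite eqEcard sub.
case=> [i iS|]; last exact: cF.
have := congr1 (fun x : V => x i) sum0.
rewrite ray_sum_coord ffunE inE iS big1 ?subr0 // => F.
by rewrite inE => /andP[/cF].
Qed.

End Rays.

Section RaySpan.
Variables (R : realType) (E : finType).
Local Notation V := {ffun E -> R^o}.
Implicit Types (S : {set E + {set E}}) (r : E + {set E}).

Definition ray_seq S : seq V := [seq ray R r | r <- enum S].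

Lemma lspan_cone S : lspan (cone S (@ray R E)) = <<ray_seq S>>%VS.
Proof.
have [sub minl] := lspanP (cone S (@ray R E)).
apply: subv_anti; apply/andP; split.
  apply: minl => v [c _ ->]; apply: memv_suml => r rS; apply: memvZ.
  by apply: memv_span; apply: map_f; rewrite mem_enum.
apply/span_subvP => v /mapP[r + ->]; rewrite mem_enum => rS.
exact/sub/cone_ray_in.
Qed.

Variable M : matroid E.

Lemma free_ray_seq S : flagset M S -> free (ray_seq S).
Proof.
move=> fS; rewrite -[ray_seq S]/(tval (in_tuple _)); apply/freeP => k sum0 i.
have szS : size (ray_seq S) = size (enum S) by rewrite size_map.
have /card_gt0P[r0 _] : (0 < #|S|)%N.
  by rewrite cardE -szS (leq_ltn_trans _ (ltn_ord i)).
pose c r := k (insubd i (index r (enum S))).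
have {}sum0 : \sum_(r in S) c r *: ray R r = 0.
  rewrite -[RHS]sum0 -big_enum /= (big_nth r0) big_mkord -szS.
  apply: eq_bigr => j _; have jS : (j < size (enum S))%N by rewrite -szS.
  rewrite /= (nth_map r0) // /c index_uniq ?enum_uniq //.
  by congr (k _ *: _); apply: val_inj; rewrite val_insubd ltn_ord.
have iS : (i < size (enum S))%N by rewrite -szS.
have := ray_sum_eq0 fS sum0 (r := nth r0 (enum S) i).
rewrite -mem_enum mem_nth // /c index_uniq ?enum_uniq // => /(_ isT).
by rewrite (_ : insubd i i = i) //; apply: val_inj; rewrite val_insubd ltn_ord.
Qed.

Lemma dim_lspan_cone S : flagset M S -> \dim (lspan (cone S (@ray R E))) = #|S|.
Proof.
by move=> fS; rewrite lspan_cone (eqP (free_ray_seq fS)) size_map -cardE.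
Qed.

(** * Identification of the fan *)

Lemma augmented_cone_ray S :
  @augmented_cone R _ (lpart S) (rpart S) = cone S (@ray R E).
Proof.
have rsum (c : E + {set E} -> R) : \sum_(r in S) c r *: ray R r =
    \sum_(i in lpart S) c (inl i) *: evec R [set i]%SET +
    \sum_(F in rpart S) c (inr F) *: - evec R (~: F)%SET.
  by rewrite big_sumType /=; congr (_ + _); apply: eq_bigl => r; rewrite inE.
apply/seteqP; split=> [_ [_ [a a0 ->] [_ [b b0 ->] <-]]|_ [c c0 ->]].
  exists (fun r => match r with inl i => a i | inr F => b F end); first by case.
  by rewrite rsum.
rewrite rsum; exists (\sum_(i in lpart S) c (inl i) *: evec R [set i]%SET).
  by exists (fun i => c (inl i)).
exists (\sum_(F in rpart S) c (inr F) *: - evec R (~: F)%SET) => //.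
by exists (fun F => c (inr F)).
Qed.

End RaySpan.

Section FanWithLoops.
Variables (R : realType) (E : finType) (M : matroid E).
Local Notation V := {ffun E -> R^o}.
Local Notation L := (loops M).
Local Notation T := {e : E | e \notin loops M}.
Local Notation N := (matroid_contraction M (loops M)).
Local Notation ext0 := (@extend0 R E L).

(** The vertex map that identifies the complex of the contraction with that of
    [M]. *)
Definition loop_ray (r : T + {set T}) : E + {set E} :=
  match r with inl i => inl (val i) | inr F => inr (add_loops F) end.

Lemma loop_ray_inj : injective loop_ray.
Proof.
move=> [i|F] [j|G] //= [].
  by move/val_inj ->.
by move/(@add_loops_inj _ M) ->.
Qed.

(** For a flat, both sides vanish on the loops, which belong to its image. *)
Lemma extend0_ray (r : T + {set T}) : ext0 (ray R r) = ray R (loop_ray r).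
Proof.
apply/ffunP => x; rewrite ffunE; case: insubP => [y _ yx|]; rewrite -?yx.
  case: r => [i|F]; first by rewrite !ray_inl (inj_eq val_inj).
  by rewrite !ray_inr mem_add_loops.
rewrite negbK => xL; case: r => [i|F] /=.
  rewrite ray_inl; case: eqP => // xi.
  by have := valP i; rewrite /= -xi xL.
by rewrite ray_inr /add_loops finset.in_setU xL orbT oppr0.
Qed.

Lemma extend0_sum (S' : {set T + {set T}}) (c : T + {set T} -> R) :
  ext0 (\sum_(r in S') c r *: ray R r) = \sum_(r in S') c r *: ray R (loop_ray r).
Proof.
have eD : {morph ext0 : x y / x + y}.
  by move=> x y; apply/ffunP => e; rewrite !ffunE; case: insubP => *; rewrite ?ffunE ?addr0.
have e0 : ext0 0 = 0.
  by apply/ffunP => e; rewrite !ffunE; case: insubP => *; rewrite ?ffunE.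
rewrite (big_morph _ eD e0); apply: eq_bigr => r _; rewrite -extend0_ray.
by apply/ffunP => e; rewrite !ffunE; case: insubP => *; rewrite ?ffunE ?scaler0.
Qed.

Lemma extend0_cone (S' : {set T + {set T}}) :
  ext0 @` cone S' (@ray R T) = cone (loop_ray @: S') (@ray R E).
Proof.
have imsum c : \sum_(r in loop_ray @: S') c r *: ray R r =
    \sum_(r in S') c (loop_ray r) *: ray R (loop_ray r).
  by rewrite big_imset //= => ? ? _ _; apply: loop_ray_inj.
apply/seteqP; split=> [_ [_ [c c0 ->] <-]|_ [c c0 ->]].
  exists (fun r => \sum_(r' | loop_ray r' == r) c r') => [r|].
    exact: sumr_ge0.
  rewrite extend0_sum imsum; apply: eq_bigr => r _; congr (_ *: _).
  by under eq_bigl do rewrite (inj_eq loop_ray_inj); rewrite big_pred1_eq.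
exists (\sum_(q in S') c (loop_ray q) *: ray R q); last by rewrite extend0_sum imsum.
by exists (fun q => c (loop_ray q)).
Qed.

Lemma lpart_loop_ray (S' : {set T + {set T}}) :
  lpart (loop_ray @: S') = [set val x | x in lpart S']%SET.
Proof.
apply/setP => x; rewrite inE; apply/imsetP/imsetP => [[[i|//] iS [->]]|[i + ->]].
  by exists i; rewrite ?inE.
by rewrite inE => iS; exists (inl i).
Qed.

Lemma rpart_loop_ray (S' : {set T + {set T}}) :
  rpart (loop_ray @: S') = (@add_loops E M @: rpart S')%SET.
Proof.
apply/setP => x; rewrite inE; apply/imsetP/imsetP => [[[//|F] iS [->]]|[F + ->]].
  by exists F; rewrite ?inE.
by rewrite inE => iS; exists (inr F).
Qed.

Definition flag_of (A : finType) (I : {set A}) (Fs : {set {set A}}) :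
    {set A + {set A}} :=
  [set r | match r with inl i => i \in I | inr F => F \in Fs end]%SET.

Lemma lpart_flag_of (A : finType) (I : {set A}) Fs : lpart (flag_of I Fs) = I.
Proof. by apply/setP => i; rewrite !inE. Qed.

Lemma rpart_flag_of (A : finType) (I : {set A}) Fs : rpart (flag_of I Fs) = Fs.
Proof. by apply/setP => i; rewrite !inE. Qed.

(** Loops can be ignored: the flats of a matroid with loops are those of the
    contraction with the loops added, and the complements do not change. *)
Lemma augmented_fanP (C : set V) : augmented_fan M C <->
  exists2 S, flagset M S & C = cone S (@ray R E).
Proof.
split=> [[_ [I [Fs [cIF ->]]] <-]|[S fS ->]].
  exists (loop_ray @: flag_of I Fs).
    rewrite /flagset lpart_loop_ray rpart_loop_ray lpart_flag_of rpart_flag_of.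
    by rewrite -compatible_contraction.
  by rewrite -extend0_cone -augmented_cone_ray lpart_flag_of rpart_flag_of.
have [I' [Fs' [lS rS]]] := compatible_from_contraction fS.
exists (@augmented_cone R _ I' Fs').
  exists I', Fs'; split=> //.
  by rewrite compatible_contraction -lS -rS.
rewrite -[I'](lpart_flag_of I' Fs') -[X in augmented_cone _ X](rpart_flag_of I' Fs').
rewrite augmented_cone_ray extend0_cone -[LHS]augmented_cone_ray.
rewrite lpart_loop_ray rpart_loop_ray lpart_flag_of rpart_flag_of -lS -rS.
exact: augmented_cone_ray.
Qed.

End FanWithLoops.

(** * Closures in the product of tropical projective lines *)

Section Topology.
Variables (R : realType) (E : finType).
Local Notation V := {ffun E -> R^o}.
Local Notation TP1 := (TP1 R E).
Local Notation emb := (@orbit_embed R E finset.set0 finset.set0).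
Implicit Types (p : TP1) (x u : V) (C : set V).

Lemma cvg_TP1 (T : Type) (F : set_system T) (FF : Filter F) (f : T -> TP1) p :
  (forall i, f t i @[t --> F] --> p i) -> f @ F --> p.
Proof.
move=> fp; apply/cvg_sup => i A /=.
rewrite (@nbhsE (initial_topology (fun f : TP1 => f i)) p).
by case=> _ [[B oB <-] Bp] /filterS; apply; apply: fp; apply: open_nbhs_nbhs.
Qed.

Lemma closed_coord (i : E) (A : set (\bar R)) :
  closed A -> closed [set p : TP1 | A (p i)].
Proof.
move=> cA; apply: (@preimage_closed _ _ (fun p : TP1 => p i)) => // p _.
exact: (@proj_continuous E (fun=> \bar R) i).
Qed.

Lemma emb_coord x i : emb x i = (x i)%:E.
Proof. by rewrite /orbit_embed !inE. Qed.

(** The face at infinity in the direction [u] is reached from inside the cone by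
    adding large multiples of [u]. *)
Lemma orbit_closure_sub (J K : {set E}) C u :
  (forall x n, C x -> C (x + n%:R *: u)) ->
  (forall i, i \in J -> 0 < u i) -> (forall i, i \in K -> u i < 0) ->
  (forall i, i \notin J :|: K -> u i = 0) ->
  closure (orbit_embed J K @` (orbit_proj J K @` C)) `<=` closure (emb @` C).
Proof.
move=> Cu uJ uK u0; rewrite closureE; apply: smallest_sub.
  exact: closed_closure.
move=> _ [_ [x Cx <-] <-].
apply: (@closed_cvg _ _ \oo _ (fun n => emb (x + n%:R *: u))).
- exact: closed_closure.
- by near=> n; apply: subset_closure; exists (x + n%:R *: u) => //; apply: Cu.
apply: cvg_TP1 => i; rewrite /orbit_embed.
under eq_fun do rewrite !inE !ffunE.
case: (boolP (i \in J)) => iJ.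
  apply/cvgeryP/cvgryPge => A; near=> n.
  rewrite -lerBlDl -ler_pdivrMr ?uJ //; near: n; exact: nbhs_infty_ger.
case: (boolP (i \in K)) => iK.
  apply/cvgerNyP/cvgrNyPle => A; near=> n.
  rewrite -lerBrDl -ler_ndivrMr ?uK //; near: n; exact: nbhs_infty_ger.
have -> : u i = 0 by apply: u0; rewrite !inE negb_or iJ iK.
rewrite ffunE inE (negPf iJ) (negPf iK).
by apply: cvg_near_cst; apply: nearW => n; rewrite scaler0 addr0.
Unshelve. all: end_near. Qed.

Lemma emb_line_continuous x : continuous (fun t : R => emb (t *: x)).
Proof.
move=> t; apply: cvg_TP1 => i.
under eq_fun do rewrite emb_coord ffunE.
rewrite emb_coord ffunE; apply: cvg_EFin; first by near=> s.
apply: cvgM; [exact: cvg_id|exact: cvg_cst].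
Unshelve. all: end_near. Qed.

Lemma connected_emb (A : set V) : A 0 ->
  (forall x (t : R), A x -> 0 <= t -> A (t *: x)) -> connected (emb @` A).
Proof.
move=> A0 At.
have -> : emb @` A = \bigcup_(x in A) ((fun t : R => emb (t *: x)) @` `[0, 1]).
  apply/seteqP; split=> [_ [x Ax <-]|_ [x Ax [t + <-]]].
    by exists x => //; exists 1; rewrite ?scale1r //= in_itv /= ler01 lexx.
  by rewrite /= in_itv /= => /andP[t0 _]; exists (t *: x) => //; apply: At.
apply: bigcup_connected.
  exists (emb 0) => x Ax; exists 0; last by rewrite scale0r.
  by rewrite /= in_itv /= lexx ler01.
move=> x _; apply: connected_continuous_connected; first exact: segment_connected.
exact/continuous_subspaceT/emb_line_continuous.
Qed.

End Topology.

Section ConeClosure.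
Variables (R : realType) (E : finType) (M : matroid E) (S : {set E + {set E}}).
Hypothesis fS : flagset M S.
Local Notation V := {ffun E -> R^o}.
Local Notation emb := (@orbit_embed R E finset.set0 finset.set0).
Local Notation cl_cone S := (closure (emb @` cone S (@ray R E))).
Implicit Types (p : TP1 R E).

Lemma closure_ge0 p j : (forall F, inr F \in S -> j \in F) ->
  cl_cone S p -> (0 <= p j)%E.
Proof.
move=> jF; move: p; rewrite closureE; apply: smallest_sub.
  exact: (closed_coord (@closed_ereal_le_ereal R 0%E)).
by move=> _ [x Cx <-] /=; rewrite emb_coord lee_fin (cone_ge0 jF Cx).
Qed.

Lemma closure_le0 p j : j \notin lpart S -> cl_cone S p -> (p j <= 0)%E.
Proof.
move=> jI; move: p; rewrite closureE; apply: smallest_sub.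
  exact: (closed_coord (@closed_ereal_ge_ereal R 0%E)).
by move=> _ [x Cx <-] /=; rewrite emb_coord lee_fin (cone_le0 jI Cx).
Qed.

(** An inequality between two coordinates becomes a union of two conditions on a
    single coordinate, closed for the order topology, when split at a constant. *)
Lemma closure_le p j k (c : R) : j \notin lpart S ->
  (forall F, inr F \in S -> k \notin F -> j \notin F) ->
  cl_cone S p -> (p j <= c%:E)%E \/ (c%:E <= p k)%E.
Proof.
move=> jI jk; move: p; rewrite closureE; apply: smallest_sub.
  apply: closedU; first exact: (closed_coord (@closed_ereal_ge_ereal R c%:E)).
  exact: (closed_coord (@closed_ereal_le_ereal R c%:E)).
move=> _ [x Cx <-] /=; rewrite !emb_coord !lee_fin.
have le := cone_le fS jI jk Cx; case: (leP (x j) c) => [|/ltW cj]; first by left.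
by right; apply: le_trans cj le.
Qed.

Lemma closure_lpart p i : cl_cone S p -> (0 < p i)%E -> i \in lpart S.
Proof. by move=> Cp; apply: contraLR => iI; rewrite -leNgt closure_le0. Qed.

(** The coordinates of a point of the cone are ordered by the chain, so the
    superlevel sets at negative heights belong to the chain. *)
Lemma closure_rpart p (c : R) : cl_cone S p -> c < 0 ->
  (forall i, p i != c%:E) ->
  [set i | (c%:E < p i)%E]%SET != finset.setT ->
  inr [set i | (c%:E < p i)%E]%SET \in S.
Proof.
move=> Cp c0 pc; set F := [set i | _]%SET => FT.
have IF : lpart S \subset F.
  apply/fintype.subsetP => i iI; rewrite inE; apply: (@lt_le_trans _ _ 0%E).
    by rewrite lte_fin.
  apply: closure_ge0 Cp => G GS; exact: fintype.subsetP (flagset_lpart fS GS) i iI.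
(* the largest member of the chain missing a given point outside F contains F *)
have above j : j \notin F -> exists G, [/\ inr G \in S, j \notin G & F \subset G].
  move=> jF; have pj : (p j < c%:E)%E.
    by rewrite lt_neqAle pc; move: jF; rewrite inE -leNgt.
  have [G0 G0S jG0] : exists2 G, inr G \in S & j \notin G.
    apply: contrapT => nG; have : (0 <= p j)%E.
      apply: closure_ge0 Cp => G GS; apply: contraT => jG.
      by case: nG; exists G.
    by rewrite leNgt (lt_trans pj) // lte_fin.
  have PG0 : (inr G0 \in S) && (j \notin G0) by rewrite G0S.
  case: (arg_maxnP (P := fun G : {set E} => (inr G \in S) && (j \notin G))
    (fun G : {set E} => #|G|) PG0) => G /andP[GS jG] maxG {G0 G0S jG0 PG0}.
  exists G; split=> //; apply/fintype.subsetP => k kF; apply: contraT => kG.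
  have kI : k \notin lpart S.
    by apply: contra kG; apply: fintype.subsetP (flagset_lpart fS GS) k.
  have kj A : inr A \in S -> j \notin A -> k \notin A.
    move=> AS jA; have le : (#|A| <= #|G|)%N by apply: maxG; rewrite AS.
    case/orP: (flagset_chain fS AS GS) => AG.
      by apply: contra kG; apply: fintype.subsetP.
    suff <- : G = A by [].
    by apply/eqP; rewrite eqEcard AG.
  case: (closure_le c kI kj Cp) => le.
    by move: kF; rewrite inE ltNge le.
  by move: pj; rewrite ltNge le.
have [j jF] : exists j, j \notin F.
  apply/existsP; rewrite -negb_forall; apply: contra FT => /forallP FT.
  by apply/eqP/setP => i; rewrite FT finset.in_setT.
have [G0 [G0S _ FG0]] := above j jF.
have PG0 : (inr G0 \in S) && (F \subset G0) by rewrite G0S.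
case: (arg_minnP (P := fun G : {set E} => (inr G \in S) && (F \subset G))
  (fun G : {set E} => #|G|) PG0) => G /andP[GS FG] minG.
suff -> : F = G by [].
apply/eqP; rewrite finset.eqEsubset FG; apply/fintype.subsetP => k kG.
apply: contraT => kF; have [A [AS kA FA]] := above k kF.
have le : (#|G| <= #|A|)%N by apply: minG; rewrite AS.
case/orP: (flagset_chain fS GS AS) => sub.
  by rewrite (fintype.subsetP sub k kG) in kA.
by rewrite (_ : A = G) ?kG // in kA; apply/eqP; rewrite eqEcard sub.
Qed.

(** For the ray of a flat [F], the superlevel set at height - 1 / 2 is [F]. *)
Lemma closure_ray r : r != inr finset.setT -> cl_cone S (emb (ray R r)) -> r \in S.
Proof.
case: r => [i|F] rT Cr.
  have := closure_lpart Cr (i := i); rewrite inE emb_coord ray_inl eqxx; apply.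
  by rewrite lte_fin ltr01.
have lt2 : (- 2^-1 : R) < 0 by rewrite oppr_lt0 invr_gt0 ltr0n.
have eqF : [set i | ((- 2^-1)%:E < emb (ray R (inr F)) i)%E]%SET = F.
  apply/setP => i; rewrite inE emb_coord ray_inr lte_fin ltrN2.
  case: (i \in F); first by rewrite invr_gt0 ltr0n.
  by rewrite ltNge invf_le1 ?ltr0n // ler1n.
have := closure_rpart Cr lt2; rewrite eqF; apply; last first.
  by apply: contraNneq rT => ->.
move=> i; rewrite emb_coord ray_inr eqe eqr_opp.
case: (i \in F); first by rewrite eq_sym invr_eq0 pnatr_eq0.
by rewrite -[1%:R]invr1 (inj_eq invr_inj) (eqr_nat R 1 2).
Qed.

(** The point of the orbit with finite coordinates 0 has the complement of [K] as
    superlevel set at height - 1. *)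
Lemma closure_orbit (J K : {set E}) : [disjoint J & K]%B ->
  cl_cone S (orbit_embed J K 0) ->
  J \subset lpart S /\ (K != finset.set0 -> inr (~: K)%SET \in S).
Proof.
move=> dJK C0; split=> [|KN0].
  apply/fintype.subsetP => i iJ; apply: closure_lpart C0 _.
  by rewrite /orbit_embed iJ.
have eqK : [set i | ((-1)%:E < orbit_embed J K (0%R : V) i)%E]%SET = (~: K)%SET.
  apply/setP => i; rewrite !inE /orbit_embed; case: ifP => [iJ|_].
    by rewrite (disjointFr dJK iJ) ltry.
  by case: ifP => //; rewrite ffunE lte_fin oppr_lt0 ltr01.
have := closure_rpart C0 (ltrN10 R); rewrite eqK; apply; last first.
  by apply: contraNneq KN0 => KT; rewrite -[K]finset.setCK KT finset.setCT.
move=> i; rewrite /orbit_embed; case: ifP => // _; case: ifP => // _.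
by rewrite ffunE eqe eq_sym oppr_eq0 oner_eq0.
Qed.

End ConeClosure.

Section ConeIncidence.
Variables (R : realType) (E : finType) (M : matroid E).
Implicit Types S : {set E + {set E}}.
Local Notation emb := (@orbit_embed R E finset.set0 finset.set0).
Local Notation cl_cone S := (closure (emb @` cone S (@ray R E))).

(** A cone is determined by the rays in its closure, so inclusion of the closures
    is inclusion of the flags. *)
Lemma cl_cone_sub S' S : flagset M S' -> flagset M S ->
  cl_cone S' `<=` cl_cone S -> S' \subset S.
Proof.
move=> fS' fS sub; apply/fintype.subsetP => r rS; apply: (closure_ray fS).
  by apply: contraTneq rS => ->; apply/negP => /(flagset_proper fS'); rewrite eqxx.
by apply/sub/subset_closure; exists (ray R r) => //; apply: cone_ray_in.
Qed.

Lemma cone_inj S' S : flagset M S' -> flagset M S ->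
  cone S' (@ray R E) = cone S (@ray R E) -> S' = S.
Proof.
move=> fS' fS eqC; apply/eqP; rewrite finset.eqEsubset.
by rewrite !cl_cone_sub // eqC.
Qed.

End ConeIncidence.

(** * Relative interiors of the cones of an orthant *)

Section Orthant.
Variables (R : realType) (E : finType).
Local Notation V := {ffun E -> R^o}.
Implicit Types (J K : {set E}) (u : V).

Local Notation e_ i := (evec R [set i]%SET).

Lemma orthant_coord J (c : E -> R) l :
  (\sum_(i in J) c i *: e_ i) l = if l \in J then c l else 0.
Proof.
rewrite sum_ffunE; under eq_bigr do rewrite !ffunE finset.in_set1.
case: ifPn => lJ.
  rewrite (bigD1 l) //= eqxx [_ *: _]mulr1 big1 ?addr0 // => i /andP[_ il].
  by rewrite eq_sym (negPf il) [_ *: _]mulr0.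
rewrite big1 // => i iJ; case: eqP => [li|]; last by rewrite [_ *: _]mulr0.
by rewrite li iJ in lJ.
Qed.

Lemma eta_coord J K u : @eta R E J K u -> exists a b : E -> R,
  [/\ forall i, 0 <= a i, forall i, 0 <= b i &
      forall l, u l = (if l \in J then a l else 0) - (if l \in K then b l else 0)].
Proof.
case=> _ [a a0 ->] [_ [b b0 ->] <-]; exists a, b; split=> // l.
under [X in _ + X]eq_bigr do rewrite scalerN.
by rewrite sumrN !ffunE !orthant_coord.
Qed.

Lemma eta_addl J K u j : @eta R E J K u -> j \in J -> eta J K (u + e_ j).
Proof.
case=> _ [a a0 ->] [y Ky <-] jJ.
exists (\sum_(i in J) (a i + (i == j)%:R) *: e_ i).
  by exists (fun i => a i + (i == j)%:R) => // i; rewrite addr_ge0 ?ler0n.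
exists y => //; rewrite addrAC; congr (_ + _).
under eq_bigr do rewrite scalerDl.
rewrite big_split; congr (_ + _).
rewrite (bigD1 j) //= eqxx scale1r big1 ?addr0 // => i /andP[_ /negPf->].
by rewrite scale0r.
Qed.

Lemma eta_addr J K u k : @eta R E J K u -> k \in K -> eta J K (u - e_ k).
Proof.
case=> x Jx [_ [b b0 ->] <-] kK; exists x => //.
exists (\sum_(i in K) (b i + (i == k)%:R) *: - e_ i).
  by exists (fun i => b i + (i == k)%:R) => // i; rewrite addr_ge0 ?ler0n.
rewrite -addrA; congr (_ + _).
under eq_bigr do rewrite scalerDl.
rewrite big_split; congr (_ + _).
rewrite (bigD1 k) //= eqxx scale1r big1 ?addr0 // => i /andP[_ /negPf->].
by rewrite scale0r.
Qed.

(** From a relatively interior point one can step back a little from any point of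
    the cone; the coordinates of the step decide the signs of [u]. *)
Lemma relint_pushback J K u v : relint (@eta R E J K) u -> eta J K (u + v) ->
  (forall i, `|v i| <= 1) -> exists2 e : R, 0 < e & eta J K (u - e *: v).
Proof.
move=> [Cu [e e0 He]] Cuv v1; exists (e / 2); first by rewrite divr_gt0 ?ltr0n.
apply: He => [|i].
  have [sub _] := lspanP [set z - u | z in @eta R E J K].
  rewrite addrAC subrr add0r memvN memvZ //; apply: sub.
  by exists (u + v) => //; rewrite addrAC subrr add0r.
rewrite !ffunE addrAC subrr add0r normrN normrM gtr0_norm ?divr_gt0 ?ltr0n //.
apply: (@le_lt_trans _ _ (e / 2)).
  by rewrite ler_piMr // divr_ge0 ?ler0n // ltW.
by rewrite ltr_pdivrMr ?ltr0n // ltr_pMr // ltr1n.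
Qed.

Lemma relint_eta_sign J K u : [disjoint J & K]%B -> relint (@eta R E J K) u ->
  [/\ forall i, i \in J -> 0 < u i, forall i, i \in K -> u i < 0 &
      forall i, i \notin J :|: K -> u i = 0].
Proof.
move=> dJK ru; have [Cu _] := ru.
have e1 (s : bool) j i : `|(-1) ^+ s * (e_ j : V) i| <= 1.
  rewrite normrM normrX normrN1 expr1n mul1r ffunE; case: (_ \in _).
    by rewrite normr1.
  by rewrite normr0 ler01.
split=> [j jJ|k kK|i].
- have [|e e0 Ce] := relint_pushback ru (eta_addl Cu jJ).
    by move=> i; have := e1 false j i; rewrite expr0 mul1r.
  have [a [b [a0 _ /(_ j)]]] := eta_coord Ce.
  rewrite jJ (disjointFr dJK jJ) subr0 !ffunE finset.in_set1 eqxx [_ *: _]mulr1.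
  by move/eqP; rewrite subr_eq => /eqP->; rewrite ltr_wpDl.
- have [|e e0 Ce] := relint_pushback ru (eta_addr Cu kK).
    by move=> i; have := e1 true k i; rewrite expr1 mulN1r !ffunE.
  have [a [b [_ b0 /(_ k)]]] := eta_coord Ce.
  rewrite kK (disjointFl dJK kK) sub0r !ffunE finset.in_set1 eqxx.
  rewrite [_ *: _]mulrN1 opprK => uk.
  have -> : u k = - (b k + e) by rewrite opprD -uk addrK.
  by rewrite oppr_lt0 ltr_wpDl.
- rewrite !inE negb_or => /andP[/negPf iJ /negPf iK].
  have [a [b [_ _ ->]]] := eta_coord Cu.
  by rewrite iJ iK subr0.
Qed.

Lemma relint_eta0 : relint (@eta R E finset.set0 finset.set0) 0.
Proof.
have eta0 : eta finset.set0 finset.set0 (0 : V).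
  exists 0; first by exists (fun=> 0); rewrite ?big_set0.
  by exists 0; [exists (fun=> 0); rewrite ?big_set0|rewrite addr0].
split=> //; exists 1 => // y; rewrite subr0 => yspan _.
have [_ min0] := lspanP [set z - 0 | z in @eta R E finset.set0 finset.set0].
have zero z : eta finset.set0 finset.set0 z -> z = 0 :> V.
  move=> Cz; have [a [b [_ _ zE]]] := eta_coord Cz.
  by apply/ffunP => i; rewrite zE !finset.in_set0 subr0 ffunE.
suff -> : y = 0 by [].
apply/eqP; rewrite -memv0; apply: (subvP (min0 0%VS _)) yspan.
by move=> _ [z /zero -> <-]; rewrite subr0 memv0.
Qed.

End Orthant.

(** * The polyhedral structure *)

Section Structure.
Variables (R : realType) (E : finType) (M : matroid E).
Local Notation V := {ffun E -> R^o}.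
Local Notation emb := (@orbit_embed R E finset.set0 finset.set0).
Local Notation coneR S := (cone S (@ray R E)).
Local Notation d := (mrank M finset.setT).
Local Notation P := (schubert_structure R M).
Implicit Types (J K : {set E}) (S : {set E + {set E}}) (s t : face R E).

Definition cone_face S : face R E := Face finset.set0 finset.set0 (coneR S).

Lemma orbit_proj_linear J K : linear (@orbit_proj R E J K).
Proof.
move=> a u v; apply/ffunP => i; rewrite !ffunE; case: ifP => // _.
by rewrite scaler0 addr0.
Qed.
HB.instance Definition _ J K := GRing.isLinear.Build R V V *:%R
  (@orbit_proj R E J K) (@orbit_proj_linear J K).

Lemma orbit_proj0 u : @orbit_proj R E finset.set0 finset.set0 u = u.
Proof. by apply/ffunP => i; rewrite ffunE !inE. Qed.

Lemma orbit_proj0_image (C : set V) :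
  orbit_proj finset.set0 finset.set0 @` C = C.
Proof.
apply/seteqP; split=> [_ [x Cx <-]|x Cx]; first by rewrite orbit_proj0.
by exists x; rewrite ?orbit_proj0.
Qed.

Lemma cone_face_structure S : flagset M S -> P (cone_face S).
Proof.
move=> fS; exists finset.set0, finset.set0, (coneR S); split.
- by rewrite finset.disjoints_subset finset.sub0set.
- by apply/augmented_fanP; exists S.
- by exists 0; split; [exact: cone_in0|exact: relint_eta0].
- by rewrite orbit_proj0_image.
Qed.

Lemma structureE t : P t -> exists J K S u,
  [/\ [disjoint J & K]%B, flagset M S, coneR S u,
      [/\ forall i, i \in J -> 0 < u i, forall i, i \in K -> u i < 0 &
          forall i, i \notin J :|: K -> u i = 0] &
      t = Face J K (orbit_proj J K @` coneR S)].
Proof.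
move=> [J [K [C [dJK /augmented_fanP[S fS ->] [u [Cu ru]] ->]]]].
by exists J, K, S, u; split=> //; apply: relint_eta_sign.
Qed.

Lemma face_pts_sub_cone t : P t -> exists2 S, flagset M S &
  face_pts t `<=` face_pts (cone_face S).
Proof.
case/structureE => J [K [S [u [_ fS Cu [uJ uK u0] ->]]]].
exists S => //; apply: (@orbit_closure_sub R E J K (coneR S) u) => // x n Cx.
by apply: cone_inD => //; apply: cone_inZ.
Qed.

Lemma flagset_full S : flagset M S ->
  exists S', [/\ S \subset S', flagset M S' & #|S'| = d].
Proof.
have [n] := ubnP (d - #|S|)%N; elim: n S => // n IHn S ltn fS.
have := flagset_leq fS; rewrite leq_eqVlt => /orP[/eqP eqd|ltd].
  by exists S.
have [r rS fr] := flagset_extend fS ltd.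
have [|S' [sub fS' cS']] := IHn (r |: S)%SET _ fr.
  by rewrite cardsU1 rS add1n subnS prednK ?subn_gt0 // -ltnS.
by exists S'; split=> //; apply: fintype.subset_trans sub; apply: finset.subsetUr.
Qed.

Lemma face_pts_cone_faceS S' S : S' \subset S ->
  face_pts (cone_face S') `<=` face_pts (cone_face S).
Proof.
by move=> sS; apply: closureS => _ [x Cx <-]; exists x => //; apply: coneS Cx.
Qed.

Lemma face_dim_cone S : flagset M S -> face_dim (cone_face S) = #|S|.
Proof. exact: dim_lspan_cone. Qed.

(** A maximal face coincides with any cone of full size that contains it. *)
Lemma structure_pure : pure_dimensional P d.
Proof.
move=> t Pt maxt; have [S fS tS] := face_pts_sub_cone Pt.
have [S' [SS' fS' cS']] := flagset_full fS.
rewrite -(maxt (cone_face S')) ?face_dim_cone //; first exact: cone_face_structure.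
exact: subset_trans tS (face_pts_cone_faceS SS').
Qed.

Lemma face_dim_proj J K S u : coneR S u -> u != 0 -> orbit_proj J K u = 0 ->
  (\dim (lspan (orbit_proj J K @` coneR S)) < \dim (lspan (coneR S)))%N.
Proof.
move=> Cu u0 pu; have [sub _] := lspanP (coneR S).
pose f : 'End(V) := linfun (orbit_proj J K).
have fE x : f x = orbit_proj J K x by rewrite lfunE.
apply: (@leq_ltn_trans (\dim (f @: lspan (coneR S)))).
  apply: dimvS; have [_] := lspanP (orbit_proj J K @` coneR S); apply.
  by move=> _ [x Cx <-]; rewrite -fE; apply/memv_img/sub.
rewrite -(limg_ker_dim f (lspan (coneR S))) -[X in (X < _)%N]add0n ltn_add2r.
rewrite lt0n dimv_eq0; apply: contraNneq u0 => cap0; rewrite -memv0 -cap0.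
by rewrite memv_cap sub // memv_ker fE pu /= eqxx.
Qed.

Lemma cells_top s : cells P d s ->
  exists2 S, flagset M S /\ #|S| = d & s = cone_face S.
Proof.
case=> /structureE[J [K [S [u [_ fS Cu [uJ uK u0] sE]]]]] ds.
have [JK0|] := eqVneq (J :|: K) finset.set0.
  move: JK0 => /eqP; rewrite finset.setU_eq0 => /andP[/eqP J0 /eqP K0].
  move: sE; rewrite J0 K0 orbit_proj0_image => sE.
  by exists S => //; split=> //; rewrite -ds sE face_dim_cone.
case/finset.set0Pn => i iJK; move: (flagset_leq fS); rewrite -ds sE => le.
have : (face_dim (Face J K (orbit_proj J K @` coneR S)) < #|S|)%N.
  rewrite -(face_dim_cone fS); apply: (face_dim_proj Cu).
    apply/eqP => u00; move: iJK; rewrite finset.in_setU => /orP[/uJ|/uK];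
      by rewrite u00 ffunE ltxx.
  apply/ffunP => j; rewrite !ffunE; case: ifPn => // jJK; exact: u0.
by rewrite ltnNge le.
Qed.

Lemma top_cells S : flagset M S -> #|S| = d -> cells P d (cone_face S).
Proof. by move=> fS cS; split; [exact: cone_face_structure|rewrite face_dim_cone]. Qed.

Lemma cone_face_inj S' S : flagset M S' -> flagset M S ->
  cone_face S' = cone_face S -> S' = S.
Proof. by move=> fS' fS [] /(cone_inj fS' fS). Qed.

Lemma facet_cone S' S : flagset M S' -> flagset M S ->
  facet (cone_face S') (cone_face S) <-> S' \subset S /\ #|S| = #|S'|.+1.
Proof.
move=> fS' fS; rewrite /facet (face_dim_cone fS') (face_dim_cone fS).
by split=> -[sub ->]; split=> //; [exact: (cl_cone_sub fS' fS sub)|exact: face_pts_cone_faceS].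
Qed.

Lemma schubert_varietyE :
  schubert_variety R M = \bigcup_(t in P) face_pts t.
Proof.
apply/seteqP; split=> [|p [t Pt tp]]; last first.
  have [S fS tS] := face_pts_sub_cone Pt.
  have := tS _ tp; apply: closureS => _ [x Cx <-]; exists x => //.
  by exists (coneR S) => //; apply/augmented_fanP; exists S.
rewrite /schubert_variety closureE; apply: smallest_sub.
  apply: closed_bigcup; first exact: schubert_structure_finite.
  by move=> t _; apply: closed_closure.
move=> _ [x [_ /augmented_fanP[S fS ->] Cx] <-].
exists (cone_face S); first exact: cone_face_structure.
by apply: subset_closure; exists x.
Qed.

(** The fan is star-shaped at the origin. *)
Lemma schubert_variety_connected : connected (schubert_variety R M).
Proof.
apply/connected_closure/connected_emb.
  have f0 : flagset M finset.set0.
    apply/flagsetP; split=> [|F|F G]; rewrite ?inE //.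
    rewrite (_ : lpart _ = finset.set0) ?indep_set0 //.
    by apply/setP => i; rewrite !inE.
  exists (coneR finset.set0); last exact: cone_in0.
  by apply/augmented_fanP; exists finset.set0.
move=> x t [C /augmented_fanP[S fS ->] Cx] t0.
exists (coneR S); first by apply/augmented_fanP; exists S.
exact: cone_inZ.
Qed.

End Structure.

(** * Determinants and exterior powers *)

Section CoordDet.
Variables (R : realType) (E : finType).
Local Notation V := {ffun E -> R^o}.
Implicit Types (x y v : V) (X Y Z : seq V).

Definition coord_det n (b : n.-tuple V) X : R :=
  \det (\matrix_(i < n, j < n) (coord b j X`_i : R)).

(** The coordinates of the left-hand family with respect to [x :: X] form a block
    triangular matrix with diagonal blocks [t] and the matrix of [Y] in [X]. *)
Lemma coord_det_consE m n (b : m.-tuple V) (X : n.-tuple V) (t : R) x y Y :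
  m = n.+1 -> y \in <<X>>%VS -> (forall i, (i < n)%N -> Y`_i \in <<X>>%VS) ->
  coord_det b (t *: x + y :: Y) = t * coord_det X Y * coord_det b (x :: X).
Proof.
move=> mn; subst m => yX YX; rewrite /coord_det.
pose A : 'M[R]_(1 + n) := block_mx t%:M (\row_(j < n) (coord X j y : R))
  0 (\matrix_(i < n, j < n) (coord X j Y`_i : R)).
have <- : \det A = t * \det (\matrix_(i < n, j < n) (coord X j Y`_i : R)).
  by rewrite det_ublock det_scalar1.
rewrite -[LHS]/(\det (\matrix_(i < 1 + n, j < 1 + n)
  (coord b j (t *: x + y :: Y)`_i : R))).
rewrite -[X in _ * X]/(\det (\matrix_(i < 1 + n, j < 1 + n)
  (coord b j (x :: X)`_i : R))).
rewrite -det_mulmx; congr (\det _); apply/matrixP => i j.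
rewrite mxE [RHS]mxE big_split_ord /= big_ord1.
case: (split_ordP i) => i' ->.
  rewrite [i']ord1 block_mxEul !mxE eqxx mulr1n /= linearP; congr (_ + _).
  rewrite [in LHS](coord_span yX) linear_sum; apply: eq_bigr => k _.
  by rewrite block_mxEur !mxE linearZ.
rewrite block_mxEdl !mxE mul0r add0r /=.
rewrite [in LHS](coord_span (YX i' (ltn_ord i'))) linear_sum; apply: eq_bigr => k _.
by rewrite block_mxEdr !mxE linearZ.
Qed.

Lemma coord_det_self n (X : n.-tuple V) : free X -> coord_det X X = 1.
Proof.
move=> fX; rewrite /coord_det -(det1 R n); congr (\det _).
by apply/matrixP => i j; rewrite !mxE coord_free.
Qed.

Lemma coord_det_perm n (b : n.-tuple V) X Y : size Y = n -> perm_eq X Y ->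
  `|coord_det b X| = `|coord_det b Y|.
Proof.
move=> sY /[dup] /perm_size sXY pXY; rewrite sY in sXY.
have /tuple_permP[p XE] : perm_eq X (tcast sY (in_tuple Y)) by rewrite val_tcast.
have -> : coord_det b X =
    \det (row_perm p (\matrix_(i < n, j < n) (coord b j Y`_i : R))).
  congr (\det _); apply/matrixP => i j; rewrite !mxE; congr (coord b j _).
  by rewrite XE -tnth_nth tnth_mktuple (tnth_nth 0) val_tcast.
by rewrite row_permE det_mulmx det_perm normrM normrX normrN1 expr1n mul1r.
Qed.

Lemma coord_det_neq0 n (b : n.-tuple V) X : free X -> size X = n ->
  (forall x, x \in X -> x \in <<b>>%VS) -> coord_det b X != 0.
Proof.
move=> fX sX Xb; apply/det0P => -[v v0 vA].
have Xi i : (i < n)%N -> X`_i \in <<b>>%VS by move=> ltin; rewrite Xb // mem_nth ?sX.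
have sum0 : \sum_(i < n) v 0 i *: X`_i = 0.
  rewrite [LHS](coord_span (X := b)); last first.
    by apply: memv_suml => i _; rewrite memvZ ?Xi.
  rewrite big1 // => j _; rewrite linear_sum.
  have := congr1 (fun B : 'rV_n => B 0 j) vA; rewrite !mxE.
  under eq_bigr do rewrite mxE.
  under [X in X *: _]eq_bigr do rewrite linearZ.
  by move=> ->; rewrite scale0r.
case/eqP: v0; apply/rowP => i; rewrite mxE.
have /freeP fX' : free (tcast sX (in_tuple X)) by rewrite val_tcast.
apply: (fX' (fun i => v 0 i)); rewrite -[RHS]sum0.
by apply: eq_bigr => j _; rewrite val_tcast.
Qed.

(** Lists instead of indexed families, so that a vector can be put in front. *)
Definition wedge_seq p X : ext R E p := wedge (fun a : 'I_p => X`_a).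

Lemma wedge_seqE p n (b : n.-tuple V) X : p = n ->
  (forall i, (i < p)%N -> X`_i \in <<b>>%VS) ->
  wedge_seq p X = coord_det b X *: wedge_seq p b.
Proof.
move=> -> Xb; apply/ffunP => i; rewrite !ffunE.
rewrite -[RHS]/(coord_det b X * \det (\matrix_(a < n, c < n) (b`_a (i c) : R))).
rewrite -det_mulmx.
congr (\det _); apply/matrixP => a c; rewrite !mxE [in LHS](coord_span (Xb a (ltn_ord a))).
rewrite sum_ffunE; apply: eq_bigr => k _.
by rewrite !mxE ffunE.
Qed.

Lemma wedge_seq_linear n (t : R) x y X :
  wedge_seq n.+1 (t *: x + y :: X) =
    t *: wedge_seq n.+1 (x :: X) + wedge_seq n.+1 (y :: X).
Proof.
apply/ffunP => i; rewrite !ffunE.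
pose B z : 'M[R]_n.+1 := \matrix_(a < n.+1, c < n.+1) ((z :: X)`_a (i c) : R).
transitivity (t * \det (B x) + 1 * \det (B y)); last by rewrite mul1r.
apply: (determinant_multilinear (i0 := ord0)).
- by apply/rowP => j; rewrite !mxE /= !ffunE mul1r.
- by apply/matrixP => k l; rewrite !mxE.
- by apply/matrixP => k l; rewrite !mxE.
Qed.

Lemma wedge_seq0 n X : wedge_seq n.+1 (0 :: X) = 0.
Proof.
have := wedge_seq_linear n 1 0 0 X.
by rewrite scale1r addr0 scale1r => /eqP; rewrite -subr_eq0 opprD addNKr oppr_eq0 => /eqP.
Qed.

Lemma wedge_seq_sum n (I : finType) (A : {set I}) (v : I -> V) X :
  wedge_seq n.+1 (\sum_(i in A) v i :: X) = \sum_(i in A) wedge_seq n.+1 (v i :: X).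
Proof.
apply: (big_morph (fun x => wedge_seq n.+1 (x :: X))) => [x y|]; last exact: wedge_seq0.
by have := wedge_seq_linear n 1 x y X; rewrite !scale1r.
Qed.

Lemma wedge_seq_span n (X : n.-tuple V) x : x \in <<X>>%VS ->
  wedge_seq n.+1 (x :: X) = 0.
Proof.
move=> xX; rewrite (wedge_seqE (b := [tuple of 0 :: X])) //.
  by rewrite /= wedge_seq0 scaler0.
move=> i ltin; have sub : (<<X>> <= <<(0%R : V) :: X>>)%VS by rewrite span_cons addvSr.
apply: (subvP sub); case: i ltin => [|i] //= ltin.
by apply/memv_span/mem_nth; rewrite size_tuple.
Qed.

Lemma ext_pow_line (n : nat) (U : {vspace V}) : \dim U = n ->
  ext_pow n U = <[wedge_seq n (vbasis U)]>%VS.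
Proof.
move=> dU; have [sub minl] :=
  lspanP [set wedge v | v in [set v : 'I_n -> V | forall a, v a \in U]].
have basisU i : (i < n)%N -> (vbasis U)`_i \in U.
  by move=> ltin; rewrite vbasis_mem ?mem_nth ?size_tuple ?dU.
apply: subv_anti; apply/andP; split.
  apply: minl => _ [v vU <-].
  have -> : wedge v = wedge_seq n (mktuple v).
    apply/ffunP => i; rewrite !ffunE; congr (\det _); apply/matrixP => a c.
    by rewrite !mxE -tnth_nth tnth_mktuple.
  rewrite (wedge_seqE (b := vbasis U)) // => [|i ltin]; first exact/memvZ/memv_line.
  rewrite (span_basis (vbasisP U)).
  have -> : (mktuple v)`_i = v (Ordinal ltin) by rewrite -(tnth_mktuple v) (tnth_nth 0).
  exact: vU.
rewrite -memvE; apply: sub; exists (fun a : 'I_n => (vbasis U)`_a) => //= a.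
exact: basisU.
Qed.

(** A vector of the span killed by the projection makes the projected basis
    linearly dependent. *)
Lemma ext_proj_kernel p n (J K : {set E}) (b : n.-tuple V) v : p = n ->
  v \in <<b>>%VS -> v != 0 -> orbit_proj J K v = 0 ->
  ext_proj J K (wedge_seq p b) = 0.
Proof.
move=> -> vb v0 pv; rewrite /wedge_seq ext_proj_wedge; apply/ffunP => i.
rewrite !ffunE; apply/eqP/det0P; exists (\row_j (coord b j v : R)).
  apply: contraNneq v0 => c0; rewrite (coord_span vb) big1 // => j _.
  by have := congr1 (fun B : 'rV_n => B 0 j) c0; rewrite !mxE => ->; rewrite scale0r.
apply/rowP => k; rewrite !mxE; have := congr1 (fun x : V => x (i k)) pv.
rewrite /= [in orbit_proj J K v](coord_span vb) linear_sum sum_ffunE [RHS]ffunE => sum0.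
rewrite -[RHS]sum0; apply: eq_bigr => a _.
by rewrite !mxE linearZ [RHS]ffunE.
Qed.

End CoordDet.

(** * Balancing *)

Section Balancing.
Variables (R : realType) (E : finType) (M : matroid E).
Local Notation V := {ffun E -> R^o}.
Local Notation d := (mrank M finset.setT).
Implicit Types S : {set E + {set E}}.

Lemma ray_in_span S r : r \in S -> ray R r \in <<ray_seq R S>>%VS.
Proof. by move=> rS; apply/memv_span/map_f; rewrite mem_enum. Qed.

Lemma ray_flat_in_span S G : G = finset.setT \/ inr G \in S ->
  ray R (inr G) \in <<ray_seq R S>>%VS.
Proof.
case=> [->|]; last exact: ray_in_span.
suff -> : ray R (inr finset.setT : E + {set E}) = 0 by rewrite mem0v.
by apply/ffunP => i; rewrite ray_inr finset.in_setT oppr0 ffunE.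
Qed.

(** If the chain skips cl(I), the rays telescope to the ray of the first member [G]
    of the chain. Otherwise a point of G minus F belongs to one of the flats of
    [Hs], a point of F to all and a point outside G to none, so that the rays add
    up to |Hs| - 1 times the ray of [F] plus that of [G]. In both cases G may be
    the whole ground set, whose ray is zero. *)
Lemma sum_ray_link S : flagset M S -> #|S|.+1 = d ->
  \sum_(r in link M S) ray R r \in <<ray_seq R S>>%VS.
Proof.
move=> fS cS; have [clS|clS] := boolP (inr (cl M (lpart S)) \in S); last first.
  have [G [GS clG ->]] := link_bottom fS cS clS.
  suff -> : \sum_(r in inr (cl M (lpart S)) |: (inl @: (G :\: cl M (lpart S))))
      ray R r = ray R (inr G) by apply: ray_flat_in_span.
  rewrite big_setU1 /=; last by apply/imsetP => -[].
  rewrite big_imset /=; last by move=> ? ? _ _ [].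
  apply/ffunP => l; rewrite ffunE.
  under eq_bigr => i _ do rewrite -[evec R _]scale1r.
  rewrite orthant_coord -/(ray R (inr _)) ray_inr ray_inr finset.in_setD.
  have [lcl|lcl] := boolP (l \in cl M (lpart S)).
    by rewrite (fintype.subsetP clG l lcl) oppr0 addr0.
  by case: (l \in G); rewrite /= ?addNr ?oppr0 ?addr0.
have [F [G [FS GS FG [Hs [-> HsFG HsP]]]]] := link_between fS cS clS.
rewrite big_imset /=; last by move=> ? ? _ _ [].
set n := \sum_(H in Hs) (1 : R).
suff -> : \sum_(H in Hs) - evec R (~: H)%SET =
    (n - 1) *: ray R (inr F) + ray R (inr G).
  by apply: memvD; [apply: memvZ; apply: ray_in_span|apply: ray_flat_in_span].
apply/ffunP => l; rewrite sum_ffunE [RHS]ffunE [X in _ = X + _]ffunE !ray_inr.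
under eq_bigr => H _ do rewrite -/(ray R (inr H)) ray_inr.
have [lF|lF] := boolP (l \in F).
  rewrite (fintype.subsetP FG l lF) oppr0 scaler0 addr0 big1 // => H HHs.
  have /andP[FH _] := HsFG H HHs.
  by rewrite (fintype.subsetP FH l lF) oppr0.
rewrite [_ *: _]mulrN1 /n sumrN.
have [lG|lG] := boolP (l \in G).
  have [|H [HHs lH] uH] := HsP l; first by rewrite finset.in_setD lF.
  rewrite oppr0 addr0 (bigD1 H) //= [in RHS](bigD1 H) //= lH add0r.
  rewrite addrAC subrr add0r; congr (- _); apply: eq_bigr => H' /andP[H'Hs H'H].
  by case: (boolP (l \in H')) => // lH'; rewrite (uH H') ?eqxx in H'H.
rewrite -opprD subrK; congr (- _); apply: eq_bigr => H HHs.
have /andP[_ HG] := HsFG H HHs.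
by rewrite (contra (fintype.subsetP HG l)).
Qed.

End Balancing.

(** * The fundamental class *)

Section FundamentalClass.
Variables (R : realType) (E : finType) (M : matroid E).
Local Notation V := {ffun E -> R^o}.
Local Notation d := (mrank M finset.setT).
Local Notation P := (schubert_structure R M).
Local Notation cface := (@cone_face R E).
Implicit Types (S : {set E + {set E}}) (s t : face R E) (r : E + {set E}).

Local Notation fbasis s := (vbasis (face_span s)).

(** Weights are functions of faces, so the rays of a cone have to be recovered
    from the face. *)
Definition flag_of_face s : {set E + {set E}} :=
  xget finset.set0 [set S | flagset M S /\ s = cone_face R S].

Lemma flag_of_cone_face S : flagset M S -> flag_of_face (cface S) = S.
Proof.
move=> fS; apply: xget_unique => [|S' [fS' eqS]]; first by [].
exact: esym (cone_face_inj fS fS' eqS).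
Qed.

(** The generator of the top exterior power for the orientation that incidence
    numbers refer to. *)
Definition face_form s : ext R E d := wedge_seq d (fbasis s).

(** The volume of the parallelotope of the rays, measured in the arbitrary basis
    from which [face_form] is made; the absolute value removes the dependence on
    the order of the rays. *)
Definition face_weight s : R :=
  `|coord_det (fbasis s) (ray_seq R (flag_of_face s))|.

Lemma span_cone_face S : face_span (cface S) = <<ray_seq R S>>%VS.
Proof. exact: lspan_cone. Qed.

Lemma span_fbasis s : <<fbasis s>>%VS = face_span s.
Proof. exact/span_basis/vbasisP. Qed.

Lemma face_weight_neq0 S : flagset M S -> face_weight (cface S) != 0.
Proof.
move=> fS; rewrite normr_eq0 flag_of_cone_face //; apply: coord_det_neq0.
- exact: free_ray_seq fS.
- by rewrite size_map -cardE -(face_dim_cone R fS).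
- by move=> x /memv_span; rewrite span_fbasis span_cone_face.
Qed.

Section AddRay.
Variables (S : {set E + {set E}}) (r : E + {set E}).
Hypotheses (rS : r \notin S) (frS : flagset M (r |: S)%SET).

Local Notation t := (cface S).
Local Notation s := (cface (r |: S)%SET).

Let fS : flagset M S. Proof. exact: flagsetS (finset.subsetUr _ _) frS. Qed.

Let dims : \dim (face_span s) = (\dim (face_span t)).+1.
Proof.
rewrite -[LHS]/(face_dim s) -[X in X.+1]/(face_dim t).
by rewrite (face_dim_cone R frS) (face_dim_cone R fS) cardsU1 rS.
Qed.

Lemma ray_seqU1 : perm_eq (ray_seq R (r |: S)%SET) (ray R r :: ray_seq R S).
Proof.
rewrite -[_ :: _]/(map (ray R (E:=E)) (r :: enum S)); apply: perm_map.
apply: uniq_perm; rewrite ?enum_uniq //= ?mem_enum ?rS ?enum_uniq // => q.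
by rewrite mem_enum !inE mem_enum.
Qed.

Lemma ray_notin_span : ray R r \notin face_span t.
Proof.
have := free_ray_seq R frS; rewrite (perm_free ray_seqU1) free_cons.
by rewrite span_cone_face => /andP[].
Qed.

Let D := coord_det (fbasis s) (ray R r :: fbasis t).

Lemma coord_det_ray (c : R) y : y \in face_span t ->
  coord_det (fbasis s) (c *: ray R r + y :: fbasis t) = c * D.
Proof.
move=> yt; rewrite (coord_det_consE (X := fbasis t) _ _ _ dims) ?span_fbasis //.
  by rewrite coord_det_self ?mulr1 // (basis_free (vbasisP _)).
by move=> i lti; rewrite vbasis_mem // mem_nth ?size_tuple.
Qed.

(** The outward directions at the facet [t] of [s] are the positive
    multiples of the negated ray, modulo the span of [t]. *)
Lemma incidence_cone : incidence s t = - Num.sg D.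
Proof.
have [sub_t _] := lspanP (cone S (@ray R E)).
apply: xget_unique => [|e [u [w [[out _] ws wE ->]]]].
  exists (- ray R r), (fbasis t); split.
  - split=> [_|[]//]; split; last by rewrite memvN ray_notin_span.
    by rewrite opprK; apply: cone_ray_in; rewrite finset.setU11.
  - move=> x /vbasis_mem; rewrite !span_cone_face; apply: subvP.
    apply: sub_span => y /mapP[q + ->]; rewrite mem_enum => qS.
    by apply: map_f; rewrite mem_enum finset.in_setU qS orbT.
  - by rewrite (eq_map (@orbit_proj0 R E)) map_id.
  - rewrite -[\det _]/(coord_det (fbasis s) (- ray R r :: fbasis t)).
    rewrite (_ : - ray R r = (-1) *: ray R r + 0); last by rewrite scaleN1r addr0.
    by rewrite coord_det_ray ?mem0v // mulN1r sgrN.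
have {wE} -> : w = fbasis t by rewrite -wE (eq_map (@orbit_proj0 R E)) map_id.
have [Cu ut] : cone (r |: S)%SET (@ray R E) (- u) /\ u \notin face_span t.
  exact: out.
have [c c0 [y Cy uE]] := coneU1 rS Cu.
have yt : y \in face_span t by apply: sub_t.
have {}uE : u = (- c) *: ray R r + - y by rewrite -[u]opprK uE opprD scaleNr.
rewrite -[\det _]/(coord_det (fbasis s) (u :: fbasis t)) uE.
rewrite coord_det_ray ?memvN // mulNr sgrN sgrM gtr0_sg ?mul1r //.
rewrite lt_neqAle c0 andbT eq_sym; apply: contraNneq ut => c00.
by rewrite uE c00 oppr0 scale0r add0r memvN.
Qed.

(** The weight of [s] turns the arbitrary orientations and bases into the wedge
    of the added ray with [t], up to a factor that depends on [t] only. *)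
Lemma incidence_weight : d = (\dim (face_span t)).+1 ->
  incidence s t *: (face_weight s *: face_form s) =
  - face_weight t *: wedge_seq d (ray R r :: fbasis t).
Proof.
move=> dE; have dE' : d = \dim (face_span s) by rewrite dE dims.
rewrite incidence_cone (wedge_seqE (b := fbasis s)) //; last first.
  rewrite dE span_fbasis => -[|i] lti /=.
    by rewrite span_cone_face ray_in_span // finset.setU11.
  have : (fbasis t)`_i \in face_span t by rewrite vbasis_mem ?mem_nth ?size_tuple.
  rewrite !span_cone_face; apply: subvP.
  apply: sub_span => y /mapP[q + ->]; rewrite mem_enum => qS.
  by apply: map_f; rewrite mem_enum finset.in_setU qS orbT.
rewrite -/D !scalerA !mulNr; congr (- _ *: _).
have -> : face_weight s = face_weight t * `|D|.
  rewrite /face_weight !flag_of_cone_face //.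
  rewrite (@coord_det_perm _ _ _ _ _ (ray R r :: ray_seq R S)) ?ray_seqU1 //; last first.
    by rewrite dims /= size_map -cardE -(face_dim_cone R fS).
  rewrite -normrM -[in LHS](scale1r (ray R r)) -[1 *: _]addr0.
  rewrite (coord_det_consE (X := fbasis t) _ _ _ dims) ?mem0v ?mul1r // => i lti.
  rewrite span_fbasis span_cone_face memv_span // mem_nth // size_map -cardE.
  by rewrite -(face_dim_cone R fS).
by rewrite mulrCA -numEsg.
Qed.

End AddRay.

(** Cones of dimension d having the cone of [S] as a facet are those of the flags
    with one vertex more. *)
Lemma sum_cofacets (W : zmodType) S (F : face R E -> W) :
  flagset M S -> #|S|.+1 = d ->
  \sum_(s \in [set s | cells P d s /\ facet (cface S) s]) F s =
  \sum_(r in link M S) F (cface (r |: S)%SET).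
Proof.
move=> fS cS; pose faces := [seq cface (r |: S)%SET | r <- enum (link M S)].
have linkP r : (r \in link M S) = (r \notin S) && flagset M (r |: S)%SET.
  by rewrite inE.
have uF : uniq faces.
  rewrite map_inj_in_uniq ?enum_uniq // => r q; rewrite !mem_enum !linkP.
  move=> /andP[rS fr] /andP[_ fq] /(cone_face_inj fr fq) eqU.
  have : r \in (q |: S)%SET by rewrite -eqU finset.setU11.
  by rewrite finset.in_setU1 (negPf rS) orbF => /eqP.
have subF : [set` faces] `<=` [set s | cells P d s /\ facet (cface S) s].
  move=> s /mapP[r]; rewrite mem_enum linkP => /andP[rS fr] ->; split.
    by apply: top_cells; rewrite // cardsU1 rS.
  apply/(facet_cone _ fS fr); rewrite cardsU1 rS; split=> //.
  exact: finset.subsetUr.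
rewrite (fsbigE faces) //.
- rewrite -big_filter (all_filterP _) ?big_map -?[RHS]big_enum //.
  by apply/allP => s /subF; rewrite inE.
- move=> s [/cells_top[S' [fS' cS'] ->] /(facet_cone _ fS fS')[SS' cSS']].
  case/negP; have [r rE] : exists r, S' :\: S = [set r]%SET.
    by apply/cards1P; rewrite finset.cardsD (finset.setIidPr SS') cSS' subSnn.
  have [rS' rS] : r \in S' /\ r \notin S.
    have : r \in S' :\: S by rewrite rE finset.set11.
    by case/finset.setDP.
  have S'E : (r |: S)%SET = S'.
    apply/eqP; rewrite eqEcard finset.subUset finset.sub1set rS' SS'.
    by rewrite cSS' cardsU1 rS add1n leqnn.
  by rewrite -S'E; apply: map_f; rewrite mem_enum linkP rS S'E.
Qed.

(** If [t] lies in the orbit (J, K), its points show that J is part of I and that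
    the complement of K, unless K is empty, is in the chain of [S]. So e_j with j
    in J, or - e_K, is a ray of the cone that is projected to zero. *)
Lemma ext_proj_form S t : flagset M S -> #|S| = d -> P t ->
  ~ (face_pos t = finset.set0 /\ face_neg t = finset.set0) ->
  face_pts t `<=` face_pts (cface S) ->
  ext_proj (face_pos t) (face_neg t) (face_form (cface S)) = 0.
Proof.
move=> fS cS /structureE[J [K [S' [_ [dJK _ _ _ ->]]]]] /= nJK0 sub.
have [JS KS] : J \subset lpart S /\ (K != finset.set0 -> inr (~: K)%SET \in S).
  apply: (closure_orbit fS dJK (R := R)); apply: sub; apply: subset_closure.
  exists 0 => //; exists 0; first exact: cone_in0.
  by apply/ffunP => i; rewrite ffunE; case: ifP; rewrite ?ffunE.
have [r rS [r0 pr]] : exists2 r, r \in S &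
    ray R r != 0 /\ orbit_proj J K (ray R r) = 0.
  have neq0 i (v : V) : v i != 0 -> v != 0.
    by apply: contraNneq => ->; rewrite ffunE.
  have [J0|/finset.set0Pn[j jJ]] := eqVneq J finset.set0; last first.
    exists (inl j); first by have := fintype.subsetP JS j jJ; rewrite inE.
    split; first by apply: (neq0 j); rewrite ray_inl eqxx oner_eq0.
    apply/ffunP => i; rewrite ffunE; case: ifPn; rewrite ?ffunE // => iJK.
    by rewrite inE; case: eqP => // ij; rewrite ij finset.in_setU jJ in iJK.
  have [K0|KN0] := eqVneq K finset.set0; first by case: nJK0.
  exists (inr (~: K)%SET); first exact: KS.
  have [k kK] := finset.set0Pn _ KN0; split.
    by apply: (neq0 k); rewrite ray_inr finset.in_setC kK oppr_eq0 oner_eq0.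
  apply/ffunP => i; rewrite ffunE; case: ifPn; rewrite ?[RHS]ffunE // => iJK.
  rewrite ray_inr finset.in_setC negbK; case: (boolP (i \in K)) => iK.
    by rewrite finset.in_setU iK orbT in iJK.
  by rewrite oppr0.
apply: (ext_proj_kernel (v := ray R r)) => //.
  by rewrite -[RHS]/(face_dim (cface S)) (face_dim_cone R fS).
by rewrite span_fbasis span_cone_face ray_in_span.
Qed.

Lemma ext_projZ p (J K : {set E}) (a : R) (f : ext R E p) :
  ext_proj J K (a *: f) = a *: ext_proj J K f.
Proof. by apply/ffunP => i; rewrite !ffunE; case: ifP; rewrite ?scaler0. Qed.

Lemma ext_proj0 p (f : ext R E p) : ext_proj finset.set0 finset.set0 f = f.
Proof.
apply/ffunP => i; rewrite ffunE ifF //.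
by apply/negbTE/existsPn => b; rewrite finset.setU0 finset.in_set0.
Qed.

Lemma cone_face_of_orbit t : P t -> face_pos t = finset.set0 ->
  face_neg t = finset.set0 -> exists2 S, flagset M S & t = cface S.
Proof.
case/structureE => J [K [S [_ [_ fS _ _ ->]]]] /= -> ->.
by exists S; rewrite // orbit_proj0_image.
Qed.

(** At infinity every summand of the boundary vanishes; in the open orbit the sum
    is the wedge of [sum_ray_link] with the face. *)
Lemma schubert_fundamental_class :
  fundamental_class P face_form face_weight.
Proof.
set c := fun s => if `[< cells P d s >] then face_weight s *: face_form s else 0.
have cE S : flagset M S -> #|S| = d ->
    c (cface S) = face_weight (cface S) *: face_form (cface S).
  by move=> fS cS; rewrite /c asboolT //; apply: top_cells.
split.
- move=> s /cells_top[S [fS cS] ->]; apply: ext_pow_line.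
  by rewrite -[LHS]/(face_dim (cface S)) (face_dim_cone R fS).
- by move=> s /cells_top[S [fS _] ->]; apply: face_weight_neq0.
rewrite -[X in BM_cycle _ _ X]/c; split; [split=> [s ds|s ns]|].
- have [S [fS cS] sE] := cells_top ds.
  rewrite /multi_tangent (fsbigD1 s) /=; first last.
  + by case: ds => Ps _; split; [|split; [split|]].
  + by apply: sub_finite_set (schubert_structure_finite R M) => s' [].
  apply: (subvP (addvSl _ _)); rewrite sE cE // memvZ //.
  rewrite (ext_pow_line (n := d)) ?memv_line //.
  by rewrite -[LHS]/(face_dim (cface S)) (face_dim_cone R fS).
- by rewrite /c asboolF.
move=> t; rewrite /BM_boundary; case: asboolP => // -[Pt dt].
have [[J0 K0]|nJK0] := pselect (face_pos t = finset.set0 /\ face_neg t = finset.set0).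
  have [S fS tE] := cone_face_of_orbit Pt J0 K0.
  have cS : #|S|.+1 = d by rewrite -dt tE (face_dim_cone R fS).
  rewrite J0 K0 tE sum_cofacets //.
  under eq_bigr => r.
    rewrite inE => /andP[rS fr]; rewrite ext_proj0 cE //; last by rewrite cardsU1 rS.
    rewrite (incidence_weight rS fr); last by rewrite -cS -(face_dim_cone R fS).
    over.
  rewrite -scaler_sumr.
  have dE : d = (\dim (face_span (cface S))).+1.
    by rewrite -cS -(face_dim_cone R fS).
  rewrite dE -wedge_seq_sum wedge_seq_span ?scaler0 //.
  by rewrite span_fbasis span_cone_face; apply: sum_ray_link.
apply: fsbig1 => s [ds [ts _]]; have [S [fS cS] sE] := cells_top ds.
rewrite sE cE // ext_projZ ext_proj_form ?scaler0 //.
by rewrite -sE.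
Qed.

End FundamentalClass.

Theorem corollary4p9 (R : realType) (E : finType) (M : matroid E) :
  tropical_variety (schubert_variety R M) (schubert_structure R M).
Proof.
split.
- exact: schubert_structure_finite.
- exact: schubert_varietyE.
- exact: schubert_variety_connected.
exists (mrank M finset.setT); split; first exact: structure_pure.
exists (@face_form R E M), (@face_weight R E M).
exact: schubert_fundamental_class.
Qed.
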